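(* Let $A>0$ be a fixed absolute constant. There exist constants $\delta_1,\mu_1>0$, which are absolute (depending on nothing except the fixed constant $A$), such that the following holds. Let $u_0\in L^\infty(\mathbb{R}^3)$ be a divergence-free vector field, let $\varepsilon, M, T>0$, let $u_{0\varepsilon}\in L^\infty(\mathbb{R}^3)$ be a divergence-free vector field, and let $f_\varepsilon$ (vector-valued) and $g_\varepsilon$ (matrix-valued) be functions on $\mathbb{R}^3\times(0,T)$ such that for every $\sigma\in[0,T)$: (1) $Ff^\sigma_\varepsilon,\ Gg^\sigma_\varepsilon\in C([0,T-\sigma),L^\infty(\mathbb{R}^3))$; (2) $\lim_{t\to0}\|Ff^\sigma_\varepsilon(t)\|_{L^\infty}=\lim_{t\to0}\|Gg^\sigma_\varepsilon(t)\|_{L^\infty}=0$; (3) $\|Ff^\sigma_\varepsilon\|_{L^\infty(\mathbb{R}^3\times(0,T-\sigma))}\le A\varepsilon M^2$, $\ \|Gg^\sigma_\varepsilon\|_{L^\infty(\mathbb{R}^3\times(0,T-\sigma))}\le A\varepsilon M^2$, $\ \|u_{0\varepsilon}-u_0\|_{L^\infty}\le A\varepsilon M^2$. Suppose the system (NSE)$_\varepsilon$ with data $u_{0\varepsilon}, f_\varepsilon, g_\varepsilon$ has a mild solution $u_\varepsilon$ on $(0,T)$ satisfying $\|u_\varepsilon\|_{L^\infty(\mathbb{R}^3\times(0,T))}\le M$. If $$\varepsilon\le\delta_1M^{-1}\exp(-\mu_1TM^2),$$ then (NSE) with initial data $u_0$ has a mild solution $u$ on $(0,T)$ with $\|u\|_{L^\infty(\mathbb{R}^3\times(0,T))}\le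 2M$.
   Context: (NSE) is the Cauchy problem for the 3D incompressible Navier-Stokes equations: $\partial_tu-\Delta u+u\nabla u+\nabla p=0$, $\operatorname{div}u=0$, $u(\cdot,0)=u_0$ on $\mathbb{R}^3$. (NSE)$_\varepsilon$ is the approximate system $\partial_tu-\Delta u+u\nabla u+\nabla p=f_\varepsilon+\operatorname{div}g_\varepsilon$, $\operatorname{div}u=0$, $u(\cdot,0)=u_{0\varepsilon}$, where $(\operatorname{div}g)_i=\sum_j\partial_jg_{ij}$. Notation: $\mathbb{P}$ is the Leray projection onto divergence-free fields on $\mathbb{R}^3$; $f^\sigma(x,t)=f(x,t+\sigma)$ is the time shift; $(Ff)(t)=\int_0^te^{(t-s)\Delta}\mathbb{P}f(s)\,ds$; $(Gg)(t)=\int_0^te^{(t-s)\Delta}\mathbb{P}\operatorname{div}g(s)\,ds$; $u\otimes v=(u_iv_j)$; $B(u,v)=-G(u\otimes v)$. It is part of the hypotheses that $Ff^\sigma_\varepsilon$ and $Gg_\varepsilon^\sigma$ are well defined. A mild solution on $(0,T)$ of the Navier-Stokes equations with right-hand side $f+\operatorname{div}g$ and initial data $w_0\in L^\infty$ is a function $u$ on $\mathbb{R}^3\times(0,T)$, bounded on $\mathbb{R}^3\times(0,T')$ for each $T'<T$, satisfying the integral equation $u(t)=e^{t\Delta}w_0+(Ff)(t)+(Gg)(t)+B(u,u)(t)$ for $t\in(0,T)$. For (NSE), $f=0$, $g=0$ and $w_0=u_0$; for (NSE)$_\varepsilon$, $f=f_\varepsilon$, $g=g_\varepsilon$, $w_0=u_{0\varepsilon}$.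 *)

(* Defs.v *)
From HB Require Import structures.
From mathcomp Require Import all_boot all_order all_algebra.
From mathcomp Require Import all_classical all_reals all_analysis.

Set Implicit Arguments.
Unset Strict Implicit.
Unset Printing Implicit Defensive.

Import Order.TTheory GRing.Theory Num.Theory.
Import numFieldNormedType.Exports.

Local Open Scope classical_set_scope.
Local Open Scope ring_scope.

(* Points of R^3 are triples, so that Lebesgue measure on R^3 is a product
   measure; the values of vector and matrix fields are row vectors and square
   matrices. Time-dependent fields take the time first: [u t] is the field u
   at time t. They are total functions; only their values at times in (0, T)
   matter. *)
Notation space3 R := (R * R * R)%type.
Notation vfield R := (space3 R -> 'rV[R]_3).
Notation vfield_t R := (R -> space3 R -> 'rV[R]_3).
Notation mfield_t R := (R -> space3 R -> 'M[R]_3).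

Section NavierStokes.
Context {R : realType}.

Local Notation leb := (@lebesgue_measure R).

Definition leb3 := ((leb \x leb) \x leb)%E.

Definition leb4 := (leb3 \x leb)%E.

Definition base3 (i : 'I_3) : space3 R :=
  ((i == 0%N :> nat)%:R, (i == 1%N :> nat)%:R, (i == 2%N :> nat)%:R).

(* The library norms on [space3 R] and on ['rV[R]_3] are sup norms. *)
Definition norm3 (x : space3 R) : R :=
  Num.sqrt (x.1.1 ^+ 2 + x.1.2 ^+ 2 + x.2 ^+ 2).

Definition enorm (v : 'rV[R]_3) : R := Num.sqrt (\sum_i v 0 i ^+ 2).

Definition pd (i : 'I_3) (f : space3 R -> R) : space3 R -> R :=
  fun x => 'D_(base3 i) f x.

Definition Linf (w : vfield R) : \bar R :=
  ('N[leb3]_+oo[EFin \o (enorm \o w)])%E.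

Definition in_Linf (w : vfield R) : Prop :=
  (forall i, measurable_fun [set: space3 R] (fun x => w x 0 i)) /\
  (Linf w < +oo)%E.

Definition slab (T : R) : set (space3 R * R) := [set: space3 R] `*` `]0, T[.

(* Extending |u| by zero outside R^3 x (0, T) does not change its essential
   supremum, since |u| >= 0. *)
Definition Linf_slab (T : R) (u : vfield_t R) : \bar R :=
  ('N[leb4]_+oo[EFin \o ((fun z => enorm (u z.2 z.1)) \_ (slab T))%R])%E.

Definition smooth (phi : space3 R -> R) : Prop :=
  forall s : seq 'I_3, continuous (foldr pd phi s) /\
    forall i (x : space3 R), derivable (foldr pd phi s) x (base3 i).

Definition test_function (phi : space3 R -> R) : Prop :=
  smooth phi /\ exists r : R, forall x, r < norm3 x -> phi x = 0.

(* div w = 0 in the sense of distributions. *)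
Definition div_free (w : vfield R) : Prop :=
  forall phi, test_function phi ->
    \int[leb3]_x (\sum_i w x 0 i * pd i phi x) = 0.

Definition convol (k f : space3 R -> R) (x : space3 R) : R :=
  \int[leb3]_y (k (x - y) * f y).

(* [Rintegral] is total; this is the absolute convergence of the integral. *)
Definition convol_defined (k f : space3 R -> R) (x : space3 R) : Prop :=
  leb3.-integrable [set: space3 R] (fun y => (k (x - y) * f y)%:E).

(* Used for t > 0 only, like every kernel and operator depending on t below,
   up to [Fop] and [Gop], which vanish at t = 0. *)
Definition heat_kernel (t : R) (x : space3 R) : R :=
  (4 * pi * t) `^ (- (3 / 2)) * expR (- (norm3 x ^+ 2 / (4 * t))).

(* e^{t Delta} w *)
Definition heat (t : R) (w : vfield R) : vfield R := fun x =>
  \row_i convol (heat_kernel t) (fun y => w y 0 i) x.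

(* Fundamental solution of - Delta on R^3. *)
Definition newton_kernel (x : space3 R) : R := (4 * pi * norm3 x)^-1.

(* P = id + grad (- Delta)^-1 div, for smooth fields decaying fast enough
   at infinity. *)
Definition leray (phi : vfield R) : vfield R := fun x =>
  phi x + \row_i
    pd i (fun y => \sum_j pd j (convol newton_kernel (fun z => phi z 0 j)) y) x.

(* Kernel of e^{t Delta} P: as P commutes with convolutions, its j-th column is
   P applied to the j-th column of [heat_kernel t] times the identity matrix. *)
Definition oseen (t : R) (i j : 'I_3) (x : space3 R) : R :=
  leray (fun y => heat_kernel t y *: 'e_j) x 0 i.

(* e^{t Delta} P f *)
Definition heat_leray (t : R) (f : vfield R) : vfield R := fun x =>
  \row_i \sum_j convol (oseen t i j) (fun y => f y 0 j) x.

(* e^{t Delta} P div g with (div g)_j = sum_k d_k g_jk; as g need not be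
   differentiable, the derivatives are carried by the kernel. *)
Definition heat_leray_div (t : R) (g : space3 R -> 'M[R]_3) : vfield R :=
  fun x =>
    \row_i \sum_j \sum_k convol (pd k (oseen t i j)) (fun y => g y j k) x.

Definition Fop (f : vfield_t R) : vfield_t R := fun t x =>
  \row_i \int[leb]_(s in `]0, t[) (heat_leray (t - s) (f s) x 0 i).

Definition Gop (g : mfield_t R) : vfield_t R := fun t x =>
  \row_i \int[leb]_(s in `]0, t[) (heat_leray_div (t - s) (g s) x 0 i).

(* [Fop f] and [Gop g] are well defined on (0, T): at every time, for almost
   every x, the space integrals (for almost every s) and then the time integral
   converge absolutely. *)
Definition Fop_defined (T : R) (f : vfield_t R) : Prop :=
  (forall i, measurable_fun (slab T) (fun z => f z.2 z.1 0 i)) /\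
  forall t : R, 0 < t < T -> {ae leb3, forall x, forall i,
    {ae leb, forall s, 0 < s < t ->
      forall j, convol_defined (oseen (t - s) i j) (fun y => f s y 0 j) x} /\
    leb.-integrable `]0, t[ (fun s => (heat_leray (t - s) (f s) x 0 i)%:E)}.

Definition Gop_defined (T : R) (g : mfield_t R) : Prop :=
  (forall i j, measurable_fun (slab T) (fun z => g z.2 z.1 i j)) /\
  forall t : R, 0 < t < T -> {ae leb3, forall x, forall i,
    {ae leb, forall s, 0 < s < t -> forall j k,
      convol_defined (pd k (oseen (t - s) i j)) (fun y => g s y j k) x} /\
    leb.-integrable `]0, t[
      (fun s => (heat_leray_div (t - s) (g s) x 0 i)%:E)}.

(* u (x) v = (u_i v_j), the values of u and v being row vectors. *)
Definition tensor (u v : vfield_t R) : mfield_t R := fun t x =>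
  (u t x)^T *m v t x.

Definition Bop (u v : vfield_t R) : vfield_t R := fun t x =>
  - Gop (tensor u v) t x.

Definition time_shift {V : Type} (sigma : R) (f : R -> V) : R -> V :=
  fun t => f (t + sigma).

(* w belongs to C([0, T), L^oo(R^3)). *)
Definition C_Linf (T : R) (w : vfield_t R) : Prop :=
  (forall t : R, 0 <= t < T -> in_Linf (w t)) /\
  forall t0 : R, 0 <= t0 < T ->
    Linf (fun x => w t x - w t0 x) @[t --> within `[0, T[ (nbhs t0)] --> 0%E.

(* Mild solution on (0, T) of the equations with right-hand side f + div g and
   initial data w0. [Gop_defined T (tensor u u)] is in fact a consequence of
   the boundedness of u. *)
Definition mild_solution (T : R) (w0 : vfield R) (f : vfield_t R)
    (g : mfield_t R) (u : vfield_t R) : Prop :=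
  [/\ forall i, measurable_fun (slab T) (fun z => u z.2 z.1 0 i),
      forall T' : R, 0 < T' < T -> (Linf_slab T' u < +oo)%E,
      [/\ Fop_defined T f, Gop_defined T g & Gop_defined T (tensor u u)] &
      forall t : R, 0 < t < T -> {ae leb3, forall x,
        u t x = heat t w0 x + Fop f t x + Gop g t x + Bop u u t x}].

End NavierStokes.

(* Main.v *)
(** The convolution of the Newton kernel 1/(4 pi |x|) with the heat kernel is a
    mixture of Gaussians, because 1/|x| is proportional to the integral over r
    of exp (- r^2 |x|^2). Differentiating the mixture three times gives the
    kernels of e^{tau Delta} P d_k, and integrating it over space bounds their
    L^1 norms by C / sqrt tau. Hence, if |g(s)| <= D e^{l s} for all s, then
    |G g(t)| <= C' D e^{l t} / sqrt l.

    The given solution u_e satisfies the equation for u_0 up to an error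
    E = 3 A eps M^2 almost everywhere. The map v |-> e^{t Delta} u_0 + B(v, v)
    is iterated from u_e: for l = (8 C' M)^2 it is a contraction by 1/2 of the
    ball of radius 2M in the norm sup e^{- l t} |v(t)| on the whole of (0, T).
    The iterates thus stay within 2 E e^{l t} of u_e in each coordinate, which
    is at most M / 3 for the given eps; so no step-by-step continuation in
    time is needed. To make all bounds pointwise, fields are set to zero
    outside a conull set S on which the almost everywhere bounds hold; this
    does not affect B, since B ignores null sets. *)

Require Import Defs.
From HB Require Import structures.
From mathcomp Require Import all_boot all_order all_algebra.
From mathcomp Require Import all_classical all_reals all_analysis.
From mathcomp Require Import measurable_realfun ess_sup_inf ring lra.

Set Implicit Arguments.
Unset Strict Implicit.
Unset Printing Implicit Defensive.

Import Order.TTheory GRing.Theory Num.Theory.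
Import numFieldNormedType.Exports.

Local Open Scope classical_set_scope.
Local Open Scope ring_scope.

(** In time, G acts like convolution with s^(-1/2), whose Laplace transform at l is sqrt (pi / l).
    This is why the weight e^{-lt} gains 1 / sqrt l, and why l of order M^2 makes B a contraction
    whatever T is. The price is the factor e^{lT} when the weight is removed: it is the origin of
    exp (- mu1 T M^2), with mu1 = (8 C')^2. The value delta1 = 1 / (18 A) collects three error terms
    of size A eps M^2, the sum 2 of a geometric series and a factor 3 from coordinates to the
    Euclidean norm.

    Two obstacles shape the rest. Partial derivatives are total operators here, so each derivative
    of the kernel must be shown to exist, at the origin too; in the mixture x enters only through
    exp (- p |x|^2), which can be differentiated under the integral. And null sets come in two
    forms, in (x, t) jointly for the bounds and in x at each t for the equation. Tonelli relates
    them at almost every t only, whereas the new solution must satisfy its equation at every t. *)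

Section MeasurableFunctions.
Context {d : measure_display} {T : measurableType d} {R : realType}.
Implicit Types (D : set T) (f g : T -> R).

Lemma measurable_fun_expR D f :
  measurable_fun D f -> measurable_fun D (fun x => expR (f x)).
Proof. by move=> mf; exact: (@measurableT_comp _ _ _ _ _ _ expR). Qed.

Lemma measurable_fun_powR D f p :
  measurable_fun D f -> measurable_fun D (fun x => f x `^ p).
Proof. by move=> mf; exact: (@measurableT_comp _ _ _ _ _ _ (@powR R ^~ p)). Qed.

Lemma measurable_fun_sqrt D f :
  measurable_fun D f -> measurable_fun D (fun x => Num.sqrt (f x)).
Proof.
move=> mf; apply: (@measurableT_comp _ _ _ _ _ _ (@Num.sqrt R) _ f) => //.
by apply: continuous_measurable_fun; exact: sqrt_continuous.
Qed.

Lemma measurable_fun_EFin D f :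
  measurable_fun D f -> measurable_fun D (fun x => (f x)%:E).
Proof. by move=> mf; exact/measurable_EFinP. Qed.

Lemma measurable_fun_norm D f :
  measurable_fun D f -> measurable_fun D (fun x => `|f x|).
Proof. by move=> mf; exact: measurableT_comp. Qed.

(** Inversion is not continuous at 0; on nonnegative numbers it agrees with the measurable power of
    exponent -1, also at 0. *)
Lemma measurable_fun_sqrtV D f : measurable_fun D f ->
  measurable_fun D (fun x => (Num.sqrt (f x))^-1).
Proof.
move=> mf.
rewrite (_ : (fun x => _) = (fun x => Num.sqrt (f x) `^ (-1))); last first.
  by apply/funext => x; rewrite powR_inv1// sqrtr_ge0.
exact/measurable_fun_powR/measurable_fun_sqrt.
Qed.

End MeasurableFunctions.

Section MeasurableProjections.
Context {d d1 d2 : measure_display} {T : measurableType d}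
  {T1 : measurableType d1} {T2 : measurableType d2}.

Lemma measurable_fun_fst (f : T -> T1 * T2) :
  measurable_fun setT f -> measurable_fun setT (fun x => (f x).1).
Proof. by move=> mf; exact: (@measurableT_comp _ _ _ _ _ _ fst _ f). Qed.

Lemma measurable_fun_snd (f : T -> T1 * T2) :
  measurable_fun setT f -> measurable_fun setT (fun x => (f x).2).
Proof. by move=> mf; exact: (@measurableT_comp _ _ _ _ _ _ snd _ f). Qed.

End MeasurableProjections.

Ltac mfun := repeat match goal with
  | H : measurable_fun ?D ?f |- measurable_fun ?D ?f => exact: H
  | |- measurable_fun _ (fun _ => ?c) => exact: measurable_cst
  | |- measurable_fun _ (fun x => x) => exact: measurable_id
  | |- measurable_fun _ (fun x => EFin _) => apply: measurable_fun_EFin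
  | |- measurable_fun _ (fun x => expR _) => apply: measurable_fun_expR
  | |- measurable_fun _ (fun x => (Num.sqrt _)^-1) => apply: measurable_fun_sqrtV
  | |- measurable_fun _ (fun x => Num.sqrt _) => apply: measurable_fun_sqrt
  | |- measurable_fun _ (fun x => powR _ _) => apply: measurable_fun_powR
  | |- measurable_fun _ (fun x => `|_|) => apply: measurable_fun_norm
  | |- measurable_fun _ (fun x => (_ + _)%R) => apply: measurable_funD
  | |- measurable_fun _ (fun x => (- _)%R) => apply: measurable_funN
  | |- measurable_fun _ (fun x => (_ * _)%R) => apply: measurable_funM
  | |- measurable_fun _ (fun x => (_ ^+ _)%R) => apply: measurable_funX
  | |- measurable_fun _ (fun x => (_ * _)%E) => apply: emeasurable_funM
  | |- measurable_fun _ (fun x => fst _) => apply: measurable_fun_fst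
  | |- measurable_fun _ (fun x => snd _) => apply: measurable_fun_snd
  | |- measurable_fun _ fst => exact: measurable_fst
  | |- measurable_fun _ snd => exact: measurable_snd
  | |- measurable_fun _ (fun x => (_, _)) => apply: measurable_fun_pair
  | |- measurable_fun _ (fun x => \sum_(_ <- _) _) => apply: measurable_sum => ?
  end.

(** No sign or integrability is assumed: Tonelli applies to the positive and negative parts
    separately, and [fine] keeps the difference measurable where it is infinite. *)
Lemma measurable_fun_Rintegral {d1 d2 : measure_display}
    {T1 : measurableType d1} {T2 : measurableType d2} {R : realType}
    (mu : {sigma_finite_measure set T2 -> \bar R}) (f : T1 -> T2 -> R) :
  measurable_fun setT (fun z => f z.1 z.2) ->
  measurable_fun setT (fun x => \int[mu]_y f x y).
Proof.
move=> mf; rewrite /Rintegral; apply: measurableT_comp.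
  exact: fine_measurable.
have mF : measurable_fun setT (fun z : T1 * T2 => (f z.1 z.2)%:E).
  exact/measurable_EFinP.
pose F z := (f z.1 z.2)%:E.
rewrite (_ : (fun x => _) = fubini_F mu F^\+ \- fubini_F mu F^\-)%E; last first.
  apply/funext => x; rewrite integralE /fubini_F/=.
  by congr (_ - _)%E; apply: eq_integral => y _; rewrite ?funeposE ?funenegE.
by apply: emeasurable_funB; apply: measurable_fun_fubini_tonelli_F => //;
  [exact: measurable_funepos|exact: measurable_funeneg].
Qed.

Lemma measurable_fun_indic_comp {d1 d2 : measure_display}
    {T1 : measurableType d1} {T2 : measurableType d2} {R : realType}
    (A : set T2) (f : T1 -> T2) : measurable A -> measurable_fun setT f ->
  measurable_fun setT (fun x => \1_A (f x) : R).
Proof.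
move=> mA mf; rewrite (_ : (fun x => _) = \1_(f @^-1` A)) //.
by apply: measurable_indic; rewrite -[X in measurable X]setTI; exact: mf.
Qed.

Lemma eq_integralT {d : measure_display} {T : measurableType d} {R : realType}
    (mu : {measure set T -> \bar R}) (f g : T -> \bar R) :
  f =1 g -> (\int[mu]_x f x = \int[mu]_x g x)%E.
Proof. by move=> fg; apply: eq_integral => x _. Qed.

(** * One-dimensional integrals *)

Section OneDimensionalIntegrals.
Context {R : realType}.
Local Notation leb := (@lebesgue_measure R).

(** The integrand is a multiple of the normal density of mean m and variance 1 / (2c). *)
Lemma integral_gauss_shift (c m : R) : 0 < c ->
  (\int[leb]_x (expR (- (c * (x - m) ^+ 2)))%:E = (Num.sqrt (pi / c))%:E)%E.
Proof.
move=> c0; pose s : R := Num.sqrt ((2 * c)^-1).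
have s2 : s ^+ 2 = (2 * c)^-1 by rewrite sqr_sqrtr// invr_ge0 mulr_ge0// ltW.
have s0 : s != 0 by rewrite gt_eqF// sqrtr_gt0 invr_gt0 mulr_gt0.
have E (x : R) : (expR (- (c * (x - m) ^+ 2)))%:E =
    (((normal_peak s)^-1)%:E * (normal_pdf m s x)%:E)%E.
  rewrite -EFinM /normal_pdf (negPf s0)/= mulKf; last first.
    by rewrite gt_eqF// normal_peak_gt0.
  rewrite /normal_fun s2; congr (expR _)%:E.
  by field; rewrite (gt_eqF c0).
under eq_integral do rewrite E.
rewrite ge0_integralZl//.
- rewrite integral_normal_pdf mule1 /normal_peak invrK s2.
  by congr (Num.sqrt _)%:E; field; rewrite (gt_eqF c0).
- by apply: measurable_fun_EFin; exact: measurable_normal_pdf.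
- by move=> x _; rewrite lee_fin normal_pdf_ge0.
- by rewrite lee_fin invr_ge0 normal_peak_ge0.
Qed.

Lemma integral_inv_quadratic (a b : R) : 0 < a -> 0 < b ->
  (\int[leb]_x ((a + b * x ^+ 2)^-1)%:E = (pi / Num.sqrt (a * b))%:E)%E.
Proof.
move=> a0 b0.
have den (x : R) : 0 < a + b * x ^+ 2.
  by rewrite ltr_pwDl// mulr_ge0 ?sqr_ge0// ltW.
pose k : R := Num.sqrt (b / a); pose l : R := Num.sqrt (a * b).
have k0 : 0 < k by rewrite sqrtr_gt0 divr_gt0.
have l0 : 0 < l by rewrite sqrtr_gt0 mulr_gt0.
have k2 : k ^+ 2 = b / a by rewrite sqr_sqrtr// divr_ge0// ltW.
have l2 : l ^+ 2 = a * b by rewrite sqr_sqrtr// mulr_ge0// ltW.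
have kl : l = a * k.
  rewrite /l (_ : a * b = a ^+ 2 * (b / a)); last by field; rewrite (gt_eqF a0).
  by rewrite sqrtrM ?sqr_ge0// sqrtr_sqr gtr0_norm.
have cf : continuous (fun x : R => (a + b * x ^+ 2)^-1).
  move=> x; apply: cvgV; first by rewrite gt_eqF.
  apply: cvgD; first exact: cvg_cst.
  by apply: cvgMl_tmp; exact: exprn_continuous.
rewrite ge0_symfun_integralT//; last 2 first.
- by move=> x; rewrite invr_ge0 ltW.
- by move=> x /=; rewrite sqrrN.
rewrite -set_itvcy.
(* The integrand is even, so the half-line suffices; [l = a * k] makes this F a primitive. *)
pose F (x : R) : R := l^-1 * atan (k * x).
have dF (x : R) : is_derive x (1 : R) F ((a + b * x ^+ 2)^-1).
  have dk : is_derive x (1 : R) (fun y : R => k * y) k.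
    by apply: is_derive_eq; rewrite /GRing.scale/= !mulr1.
  have dc := is_derive1_comp (is_derive1_atan (k * x)) dk.
  apply: (@is_derive_eq _ _ _ _ _ _ _ _ (is_deriveZ l^-1 dc)).
  rewrite /GRing.scale/= exprMn k2 kl.
  have := den x; move: (den x) => /gt_eqF h _.
  field; rewrite (gt_eqF k0) (gt_eqF a0) ?h //.
rewrite (@ge0_continuous_FTC2y R _ F 0 (l^-1 * (pi / 2)))//.
- rewrite /F mulr0 atan0 mulr0 sube0 -EFinM; congr EFin.
  by rewrite -/l; field; rewrite (gt_eqF l0).
- by move=> x _; rewrite invr_ge0 ltW.
- exact: continuous_subspaceT.
- apply: cvgMl_tmp; apply: (@cvg_comp _ _ _ (fun x : R => k * x) (@atan R) _ _ _ _ (@cvgy_atan R)).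
  exact: gt0_cvgMry.
- have /derivable1_diffP/differentiable_continuous := @ex_derive _ _ _ _ _ _ _ (dF 0).
  exact: cvg_at_right_filter.
- by move=> x _; rewrite derive1E; exact: derive_val.
Qed.

Lemma integral_expR_lin (k c t : R) : 0 < k -> 0 <= t ->
  (\int[leb]_(s in `]0%R, t[) (expR (k * s + c))%:E <=
    (k^-1 * expR (k * t + c))%:E)%E.
Proof.
move=> k0; rewrite le_eqVlt => /predU1P[<-|t0].
  by rewrite set_itvoo0 integral_set0 lee_fin mulr_ge0 ?expR_ge0// invr_ge0 ltW.
have cf : continuous (fun s : R => expR (k * s + c)).
  move=> s; apply: (@continuous_comp _ _ _ (fun s : R => k * s + c) expR).
    by apply: cvgD; [apply: cvgMl_tmp; exact: cvg_id|exact: cvg_cst].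
  exact: continuous_expR.
pose F (s : R) : R := k^-1 * expR (k * s + c).
have dF (s : R) : is_derive s (1 : R) F (expR (k * s + c)).
  have dk : is_derive s (1 : R) (fun y : R => k * y + c) k.
    by apply: is_derive_eq; rewrite /GRing.scale/= !mulr1 addr0.
  have dc := @is_derive1_comp R expR (fun y : R => k * y + c) s _ _ (is_derive_expR _) dk.
  apply: (@is_derive_eq _ _ _ _ _ _ _ _ (is_deriveZ k^-1 dc)).
  rewrite /GRing.scale/=; field; rewrite (gt_eqF k0) //.
have cF (s : R) : {for s, continuous F}.
  by have /derivable1_diffP/differentiable_continuous := @ex_derive _ _ _ _ _ _ _ (dF s).
apply: (@le_trans _ _ (\int[leb]_(s in `[0%R, t]) (expR (k * s + c))%:E)%E).
  apply: ge0_subset_integral => //.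
  - apply: measurable_fun_EFin; apply: measurable_funTS.
    exact: continuous_measurable_fun.
  - by apply: subset_itvW.
rewrite (@continuous_FTC2 R _ F 0 t)//.
- rewrite /F -EFinD lee_fin gerBl mulr_ge0 ?expR_ge0// invr_ge0 ltW //.
- exact: continuous_subspaceT.
- split.
  + by move=> s _; exact: (@ex_derive _ _ _ _ _ _ _ (dF s)).
  + exact/cvg_at_right_filter/cF.
  + exact/cvg_at_left_filter/cF.
- by move=> s _; rewrite derive1E; exact: derive_val.
Qed.

Lemma invr_sqrt_gauss (s : R) : 0 < s ->
  (((Num.sqrt s)^-1)%:E =
    ((Num.sqrt pi)^-1)%:E * \int[leb]_r (expR (- (s * r ^+ 2)))%:E)%E.
Proof.
move=> s0; have := @integral_gauss_shift _ 0 s0.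
under eq_integral do rewrite subr0.
move=> ->; rewrite sqrtrM ?pi_ge0// sqrtrV ?ltW// -EFinM mulKf//.
by rewrite gt_eqF// sqrtr_gt0 pi_gt0.
Qed.

(* By [invr_sqrt_gauss], [(t - s)^(-1/2)] is an integral of [exp (- (t - s) r^2)]
   over r; exchanging the integrals avoids the singularity at [s = t]. *)
Lemma integral_sqrtV_expR (l t : R) : 0 < l -> 0 <= t ->
  (\int[leb]_(s in `]0%R, t[) ((Num.sqrt (t - s))^-1 * expR (l * s))%:E <=
    (Num.sqrt (pi / l) * expR (l * t))%:E)%E.
Proof.
move=> l0 t0; pose D : set R := `]0%R, t[%classic.
pose F (z : measurableTypeR R * measurableTypeR R) : \bar R :=
  (\1_D z.1 * expR (- ((t - z.1) * z.2 ^+ 2) + l * z.1))%:E.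
have mF : measurable_fun setT F.
  rewrite /F; mfun; apply: (@measurable_fun_indic_comp _ _ _ (measurableTypeR R) R D fst).
    exact: measurable_itv.
  exact: measurable_fst.
have F0 z : (0 <= F z)%E by rewrite lee_fin mulr_ge0 ?expR_ge0.
have quad0 (x : R) : 0 < l + 1 * x ^+ 2 by rewrite ltr_pwDl// mul1r sqr_ge0.
have mquad : measurable_fun [set: measurableTypeR R]
    (fun x : measurableTypeR R => ((l + 1 * x ^+ 2)^-1)%:E).
  apply: measurable_fun_EFin; apply: continuous_measurable_fun => x.
  apply: cvgV; first by rewrite gt_eqF.
  apply: cvgD; first exact: cvg_cst.
  by apply: cvgMl_tmp; exact: exprn_continuous.
have sp0 : 0 < Num.sqrt pi :> R by rewrite sqrtr_gt0 pi_gt0.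
have -> : (\int[leb]_(s in `]0%R, t[) ((Num.sqrt (t - s))^-1 * expR (l * s))%:E =
    ((Num.sqrt pi)^-1)%:E * \int[leb]_s \int[leb]_r F (s, r))%E.
  rewrite -ge0_integralZl//; last 2 first.
  - exact: (measurable_fun_fubini_tonelli_F F mF F0).
  - by move=> s _; exact: integral_ge0.
  rewrite [LHS]integral_mkcond.
  apply: eq_integralT => s; rewrite patchE.
  rewrite /F /=; case: ifPn => [|sD].
    move=> sD; rewrite indicE sD.
    move: sD; rewrite inE /D/= in_itv/= => /andP[s0 st].
    rewrite EFinM (@invr_sqrt_gauss (t - s)) ?subr_gt0// -muleA.
    congr (_ * _)%E; rewrite -ge0_integralZr//; last by mfun.
    by apply: eq_integral => r _; rewrite mul1r expRD EFinM.
  by rewrite indicE (negPf sD) integral0_eq ?mule0// => r _; rewrite mul0r.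
rewrite (fubini_tonelli F mF F0).
rewrite (_ : _ * _ = (Num.sqrt pi)^-1 * (pi / Num.sqrt (l * 1) * expR (l * t))); last first.
  rewrite sqrtrM ?pi_ge0// sqrtrV ?ltW// mulr1 mulrA; congr (_ * _).
  by rewrite mulrA -{3}[pi]sqr_sqrtr ?pi_ge0// expr2 mulKf ?gt_eqF.
rewrite [leRHS]EFinM; apply: lee_wpmul2l; first by rewrite lee_fin invr_ge0 ltW.
rewrite EFinM -integral_inv_quadratic// -ge0_integralZr//; last first.
  by move=> x _; rewrite lee_fin invr_ge0 ltW.
apply: ge0_le_integral; [by []|by move=> r _; exact: integral_ge0| | |].
- exact: (measurable_fun_fubini_tonelli_G F mF F0).
- by apply: emeasurable_funM => //; exact: mquad.
(* For fixed r the exponent is k s - t r^2, and k t - t r^2 = l t: the integral over s is at most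
   e^{lt} / (l + r^2), which is integrable in r. *)
move=> r _; pose k := l + 1 * r ^+ 2.
have k0 : 0 < k by rewrite ltr_pwDl// mulr_ge0// sqr_ge0.
apply: le_trans (_ : (k^-1 * expR (k * t + - (t * r ^+ 2)))%:E <= _)%E; last first.
  by rewrite -EFinM lee_fin ler_pM2l ?invr_gt0// ler_expR /k; lra.
apply: (le_trans _ (@integral_expR_lin k (- (t * r ^+ 2)) t k0 t0)).
rewrite [leRHS]integral_mkcond; apply: ge0_le_integral; [by []|by move=> s _; exact: F0| | |].
- exact: measurable_fun_pair1.
- apply/(measurable_restrictT _ (measurable_itv _)).
  by apply: measurable_funTS; mfun.
move=> s _; rewrite patchE /F/= indicE; case: ifPn => _.
  by rewrite mul1r lee_fin ler_expR /k; lra.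
by rewrite mul0r.
Qed.

End OneDimensionalIntegrals.

(** * Sigma-finiteness of Lebesgue measure on R^2 and R^3 *)

Lemma sigma_finite_prod {d1 d2 : measure_display} {T1 : measurableType d1}
    {T2 : measurableType d2} {R : realType}
    (m1 : {sigma_finite_measure set T1 -> \bar R})
    (m2 : {sigma_finite_measure set T2 -> \bar R}) :
  sigma_finite setT (m1 \x m2)%E.
Proof.
have [F TF mF] := @sigma_finiteT _ _ _ m1.
have [G TG mG] := @sigma_finiteT _ _ _ m2.
pose H n := if @unpickle (nat * nat)%type n is Some p then F p.1 `*` G p.2 else set0.
exists H => [|n].
  apply/seteqP; split=> // -[x y] _.
  have [i _ Fi] : (\bigcup_i F i) x by rewrite -TF.
  have [j _ Gj] : (\bigcup_j G j) y by rewrite -TG.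
  by exists (pickle (i, j)) => //; rewrite /H pickleK.
rewrite /H; case: unpickle => [[i j]/=|]; last by rewrite measure0 ltry.
have [mFi Fi] := mF i; have [mGj Gj] := mG j.
split; first exact: measurableX.
by rewrite product_measure1E// lte_mul_pinfty// ge0_fin_numE.
Qed.

Section SigmaFiniteLebesgue.
Context {R : realType}.
Local Notation leb := (@lebesgue_measure R).

(* The canonical sigma-finite structure of [product_measure1] is the one of
   products of subprobabilities, hence these instances on copies of the
   Lebesgue measures. *)
Definition leb2s := (leb \x leb)%E.
HB.instance Definition _ := Measure.on leb2s.
HB.instance Definition _ := Measure_isSigmaFinite.Build _ _ _ leb2s
  (sigma_finite_prod leb leb).

Definition leb3s := (leb2s \x leb)%E.
HB.instance Definition _ := Measure.on leb3s.
HB.instance Definition _ := Measure_isSigmaFinite.Build _ _ _ leb3s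
  (sigma_finite_prod leb2s leb).

End SigmaFiniteLebesgue.

(** * Gaussian mixtures *)

Section GaussianIntegrals.
Context {R : realType}.
Local Notation leb := (@lebesgue_measure R).
Local Notation leb3 := (@leb3 R).
Implicit Types (x y : space3 R) (tau s : R).

Lemma norm3_sq x : norm3 x ^+ 2 = x.1.1 ^+ 2 + x.1.2 ^+ 2 + x.2 ^+ 2.
Proof. by rewrite sqr_sqrtr// !addr_ge0// sqr_ge0. Qed.

(** Tonelli is applied with the sigma-finite copy [leb2s], which is convertible to [leb \x leb]. *)
Lemma fubini_leb3 (F : (measurableTypeR R * measurableTypeR R) * measurableTypeR R -> \bar R) :
  measurable_fun setT F -> (forall z, 0 <= F z)%E ->
  (\int[leb3]_y F y = \int[leb]_u \int[leb]_v \int[leb]_w F ((u, v), w))%E.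
Proof.
move=> mF F0.
have mG : measurable_fun setT
    (fun z : measurableTypeR R * measurableTypeR R => \int[leb]_w F (z, w))%E.
  exact: (@measurable_fun_fubini_tonelli_F _ _ _ _ R leb F mF F0).
have G0 z : (0 <= \int[leb]_w F (z, w))%E by exact: integral_ge0.
transitivity (\int[(leb \x leb)%E]_z \int[leb]_w F (z, w))%E.
  exact: (@fubini_tonelli1 _ _ _ _ R (@leb2s R) leb F mF F0).
exact: (@fubini_tonelli1 _ _ _ _ R leb leb _ mG G0).
Qed.

Lemma integral_leb3_prod (f g h : R -> R) :
  (forall r, 0 <= f r) -> (forall r, 0 <= g r) -> (forall r, 0 <= h r) ->
  measurable_fun [set: measurableTypeR R] (f : measurableTypeR R -> R) ->
  measurable_fun [set: measurableTypeR R] (g : measurableTypeR R -> R) ->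
  measurable_fun [set: measurableTypeR R] (h : measurableTypeR R -> R) ->
  (\int[leb3]_y (f y.1.1 * g y.1.2 * h y.2)%:E =
   (\int[leb]_r (f r)%:E) * (\int[leb]_r (g r)%:E) * (\int[leb]_r (h r)%:E))%E.
Proof.
move=> f0 g0 h0 mf mg mh.
have mEf : measurable_fun [set: measurableTypeR R] (fun r : measurableTypeR R => (f r)%:E).
  exact: measurable_fun_EFin.
have mEg : measurable_fun [set: measurableTypeR R] (fun r : measurableTypeR R => (g r)%:E).
  exact: measurable_fun_EFin.
have mEh : measurable_fun [set: measurableTypeR R] (fun r : measurableTypeR R => (h r)%:E).
  exact: measurable_fun_EFin.
pose F (z : (measurableTypeR R * measurableTypeR R) * measurableTypeR R) : \bar R :=
  (f z.1.1 * g z.1.2 * h z.2)%:E.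
have mF : measurable_fun setT F.
  apply: measurable_fun_EFin; apply: measurable_funM; last first.
    apply: (@measurableT_comp _ _ _ _ _ _ h) => //; exact: measurable_snd.
  apply: measurable_funM.
    apply: (@measurableT_comp _ _ _ _ _ _ f) => //; apply: measurable_fun_fst.
    exact: measurable_fst.
  apply: (@measurableT_comp _ _ _ _ _ _ g) => //; apply: measurable_fun_snd.
  exact: measurable_fst.
have F0 z : (0 <= F z)%E by rewrite lee_fin !mulr_ge0.
have E3 (c : R) : 0 <= c ->
    (\int[leb]_r (c * h r)%:E = c%:E * \int[leb]_r (h r)%:E)%E.
  by move=> c0; rewrite -ge0_integralZl// => r _; rewrite lee_fin.
transitivity (\int[leb3]_y F y)%E; first by [].
rewrite (fubini_leb3 mF F0).
have If0 : (0 <= \int[leb]_u (g u)%:E)%E by apply: integral_ge0 => r _; rewrite lee_fin.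
have Ih0 : (0 <= \int[leb]_u (h u)%:E)%E by apply: integral_ge0 => r _; rewrite lee_fin.
transitivity (\int[leb]_u ((f u)%:E * (\int[leb]_v (g v)%:E * \int[leb]_w (h w)%:E)))%E.
  apply: eq_integralT => u.
  transitivity (\int[leb]_v (((f u)%:E * \int[leb]_w (h w)%:E) * (g v)%:E))%E.
    apply: eq_integralT => v; rewrite /F/= E3 ?mulr_ge0// EFinM.
    by rewrite -!muleA; congr (_ * _)%E; rewrite muleC.
  rewrite ge0_integralZl//.
  - by rewrite -muleA; congr (_ * _)%E; rewrite muleC.
  - by move=> v _; rewrite lee_fin.
  - by rewrite mule_ge0// lee_fin.
rewrite ge0_integralZr//; first by rewrite muleA.
- by move=> v _; rewrite lee_fin.
- exact: mule_ge0.
Qed.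

(** The constant [e] receives the remainder left by completing a square. *)
Lemma integral_gauss3 (c e : R) (m : space3 R) : 0 < c ->
  (\int[leb3]_y (expR (- (c * norm3 (y - m) ^+ 2 + e)))%:E =
    (Num.sqrt (pi / c) ^+ 3 * expR (- e))%:E)%E.
Proof.
move=> c0; pose f (a r : R) : R := expR (- (c * (r - a) ^+ 2)).
have mf a : measurable_fun [set: measurableTypeR R] (f a : measurableTypeR R -> R).
  by rewrite /f; mfun.
transitivity (\int[leb3]_y ((expR (- e))%:E * (f m.1.1 y.1.1 * f m.1.2 y.1.2 * f m.2 y.2)%:E))%E.
  apply: eq_integralT => y; rewrite -EFinM; congr EFin.
  by rewrite norm3_sq/= /f -!expRD; congr expR; ring.
rewrite ge0_integralZl//.
- rewrite (@integral_leb3_prod (f m.1.1) (f m.1.2) (f m.2)) ?(@integral_gauss_shift R)//.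
  + by rewrite -!EFinM mulrC !exprS expr0 mulr1 -!mulrA.
  + by move=> r; exact: expR_ge0.
  + by move=> r; exact: expR_ge0.
  + by move=> r; exact: expR_ge0.
- by rewrite /f; mfun.
- by move=> y _; rewrite lee_fin !mulr_ge0// expR_ge0.
Qed.

Definition kappa tau : R := (4 * tau)^-1.

(** The heat flow turns exp (- r^2 |x|^2) into shrink^3 exp (- freq^2 |x|^2) after time tau: the
    width 1 / r grows by the factor 1 / shrink and the total mass is kept. *)
Definition shrink tau (r : R) : R := (Num.sqrt (1 + 4 * tau * r ^+ 2))^-1.

Definition freq tau (r : R) : R := r * shrink tau r.

(* For s = |x|^2, [psi 0 tau s] is up to a factor the convolution of the Newton
   and heat kernels at x; the factor [shrink ^+ 3] comes from the Gaussian
   integral over R^3 and [freq ^+ (2 * m)] from m derivatives in s. *)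
Definition psi (m : nat) tau s : R :=
  \int[leb]_r (shrink tau r ^+ 3 * freq tau r ^+ (2 * m) *
    expR (- (freq tau r ^+ 2 * s))).

Lemma kappa_gt0 tau : 0 < tau -> 0 < kappa tau.
Proof. by move=> t0; rewrite invr_gt0 mulr_gt0. Qed.

Lemma shrink_den tau (r : R) : 0 < tau -> 0 < 1 + 4 * tau * r ^+ 2.
Proof. by move=> t0; rewrite ltr_pwDl// mulr_ge0 ?sqr_ge0// mulr_ge0// ltW. Qed.

Lemma shrink_gt0 tau (r : R) : 0 < tau -> 0 < shrink tau r.
Proof. by move=> t0; rewrite invr_gt0 sqrtr_gt0 shrink_den. Qed.

Lemma shrink_sq tau (r : R) : 0 < tau ->
  shrink tau r ^+ 2 = (1 + 4 * tau * r ^+ 2)^-1.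
Proof. by move=> t0; rewrite exprVn sqr_sqrtr// ltW// shrink_den. Qed.

Lemma shrink_le1 tau (r : R) : 0 < tau -> shrink tau r <= 1.
Proof.
move=> t0; rewrite /shrink invf_le1 ?sqrtr_gt0 ?shrink_den//.
rewrite -[leLHS]sqrtr1 ler_wsqrtr// lerDl mulr_ge0 ?sqr_ge0//.
by rewrite mulr_ge0// ltW.
Qed.

Lemma shrink3_le tau (r : R) : 0 < tau ->
  shrink tau r ^+ 3 <= (1 + 4 * tau * r ^+ 2)^-1.
Proof.
move=> t0; rewrite -shrink_sq// exprS ler_piMl ?sqr_ge0//.
exact: shrink_le1.
Qed.

Lemma freq_sq tau (r : R) : 0 < tau ->
  freq tau r ^+ 2 = r ^+ 2 / (1 + 4 * tau * r ^+ 2).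
Proof. by move=> t0; rewrite exprMn shrink_sq. Qed.

(** No Gaussian of the mixture is narrower than the heat kernel itself, as freq^2 increases to kappa
    when r grows. This uniform bound in r permits domination. *)
Lemma freq_sq_le tau (r : R) : 0 < tau -> freq tau r ^+ 2 <= kappa tau.
Proof.
move=> t0; rewrite freq_sq// /kappa ler_pdivrMr ?shrink_den//.
rewrite mulrDr mulr1 mulrA mulVf ?mul1r; last by rewrite gt_eqF// mulr_gt0.
by rewrite lerDr invr_ge0 mulr_ge0// ltW.
Qed.

Lemma measurable_psi_integrand (m : nat) :
  measurable_fun [set: (measurableTypeR R * measurableTypeR R) * measurableTypeR R]
    (fun z : (measurableTypeR R * measurableTypeR R) * measurableTypeR R =>
      shrink z.1.1 z.2 ^+ 3 * freq z.1.1 z.2 ^+ (2 * m) *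
      expR (- (freq z.1.1 z.2 ^+ 2 * z.1.2))).
Proof. by rewrite /freq /shrink; mfun. Qed.

Lemma measurable_psi (m : nat) : measurable_fun [set: measurableTypeR R * measurableTypeR R]
  (fun z : measurableTypeR R * measurableTypeR R => psi m z.1 z.2).
Proof. 
exact: (@measurable_fun_Rintegral _ _ _ _ _ leb
  (fun (z : measurableTypeR R * measurableTypeR R) (r : measurableTypeR R) =>
    shrink z.1 r ^+ 3 * freq z.1 r ^+ (2 * m) * expR (- (freq z.1 r ^+ 2 * z.2)))
  (measurable_psi_integrand m)). Qed.

Lemma integrable_inv_quadratic (a b c : R) : 0 < a -> 0 < b ->
  leb.-integrable [set: measurableTypeR R]
    (fun r : measurableTypeR R => (c * (a + b * r ^+ 2)^-1)%:E).
Proof.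
move=> a0 b0.
have m1 : measurable_fun [set: measurableTypeR R]
    (fun r : measurableTypeR R => ((a + b * r ^+ 2)^-1)%:E).
  apply: measurable_fun_EFin; apply: continuous_measurable_fun => x.
  apply: cvgV; first by rewrite gt_eqF// ltr_pwDl// mulr_ge0 ?sqr_ge0// ltW.
  apply: cvgD; first exact: cvg_cst.
  by apply: cvgMl_tmp; exact: exprn_continuous.
under eq_fun do rewrite EFinM.
apply: integrableZl => //; apply/integrableP; split=> //.
under eq_integral.
  move=> x _; rewrite gee0_abs; last first.
    rewrite lee_fin invr_ge0 addr_ge0 ?(ltW a0)//.
    by rewrite mulr_ge0 ?sqr_ge0 ?(ltW b0).
  over.
by rewrite integral_inv_quadratic// ltry.
Qed.

(** Negative s are included because s = |x|^2 vanishes at the origin, where a two-sided derivative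
    in s is still wanted. *)
Lemma psi_integrand_le (m : nat) tau s (r : R) : 0 < tau ->
  `|shrink tau r ^+ 3 * freq tau r ^+ (2 * m) * expR (- (freq tau r ^+ 2 * s))|
  <= kappa tau ^+ m * expR (kappa tau * `|s|) * (1 + 4 * tau * r ^+ 2)^-1.
Proof.
move=> t0; set a := _ ^+ 3; set b := _ ^+ (2 * m); set e := expR _.
have a0 : 0 <= a by apply/exprn_ge0/ltW/shrink_gt0.
have b0 : 0 <= b by rewrite /b exprM exprn_ge0// sqr_ge0.
have e0 : 0 <= e by exact: expR_ge0.
rewrite ger0_norm; last by apply: mulr_ge0 => //; exact: mulr_ge0.
rewrite (_ : a * b * e = b * e * a); last by ring.
apply: ler_pM; [exact: mulr_ge0|by []| |exact: shrink3_le].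
apply: ler_pM => //.
  rewrite /b exprM; apply: lerXn2r; rewrite ?nnegrE ?sqr_ge0//.
    exact/ltW/kappa_gt0.
  exact: freq_sq_le.
rewrite /e ler_expR; apply: (le_trans (ler_norm _)); rewrite normrN normrM.
by apply: ler_wpM2r => //; rewrite ger0_norm ?sqr_ge0// freq_sq_le.
Qed.

Lemma psi_integrable (m : nat) tau s : 0 < tau ->
  leb.-integrable [set: measurableTypeR R] (fun r : measurableTypeR R =>
    (shrink tau r ^+ 3 * freq tau r ^+ (2 * m) * expR (- (freq tau r ^+ 2 * s)))%:E).
Proof.
move=> t0.
apply: (le_integrable _ _ _ (@integrable_inv_quadratic 1 (4 * tau)
  (kappa tau ^+ m * expR (kappa tau * `|s|)) _ _)) => //.
- by rewrite /freq /shrink; mfun.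
- move=> r _; rewrite lee_fin; apply: (le_trans (psi_integrand_le _ _ _ t0)).
  exact: ler_norm.
- by rewrite mulr_gt0.
Qed.

Lemma is_derive_psi (m : nat) tau s : 0 < tau ->
  is_derive s (1 : R) (psi m tau) (- psi m.+1 tau s).
Proof.
move=> t0; pose f (u : R) (r : measurableTypeR R) : R :=
  shrink tau r ^+ 3 * freq tau r ^+ (2 * m) * expR (- (freq tau r ^+ 2 * u)).
pose f' (u : R) (r : measurableTypeR R) : R :=
  - (shrink tau r ^+ 3 * freq tau r ^+ (2 * m.+1) * expR (- (freq tau r ^+ 2 * u))).
have df (u : R) (r : measurableTypeR R) : is_derive u (1 : R) (f ^~ r) (f' u r).
  have dk : is_derive u (1 : R) (fun y : R => - (freq tau r ^+ 2 * y)) (- freq tau r ^+ 2).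
    by apply: is_derive_eq; rewrite /GRing.scale/= !mulr1.
  have dc := @is_derive1_comp R expR (fun y : R => - (freq tau r ^+ 2 * y)) u _ _
    (is_derive_expR _) dk.
  apply: (@is_derive_eq _ _ _ _ _ _ _ _
    (is_deriveZ (shrink tau r ^+ 3 * freq tau r ^+ (2 * m)) dc)).
  rewrite /GRing.scale/= /f' mulnS !exprD; ring.
(* The summand 1 makes the majorant valid for every u in the window ]s - 1, s + 1[. *)
pose C : R := kappa tau ^+ m.+1 * expR (kappa tau * (`|s| + 1)).
pose G (r : measurableTypeR R) : R := C * (1 + 4 * tau * r ^+ 2)^-1.
have C0 : 0 <= C by rewrite mulr_ge0 ?expR_ge0// exprn_ge0// ltW// kappa_gt0.
have Is : `](s - 1), (s + 1)[%classic s by rewrite /= in_itv/=; apply/andP; split; lra.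
have intf (u : R) : leb.-integrable [set: measurableTypeR R] (EFin \o f u).
  exact: psi_integrable.
have der (u : R) (r : measurableTypeR R) : derivable (f ^~ r) u 1.
  exact: (@ex_derive _ _ _ _ _ _ _ (df u r)).
have G0 (r : measurableTypeR R) : 0 <= G r.
  by rewrite mulr_ge0// invr_ge0 ltW// shrink_den.
have intG : leb.-integrable [set: measurableTypeR R] (EFin \o G).
  by apply: integrable_inv_quadratic; rewrite ?mulr_gt0.
have dfE (u : R) (r : measurableTypeR R) : partial1of2 f u r = f' u r.
  by rewrite partial1of2E; exact: derive_val.
have Gub (u : R) (r : measurableTypeR R) : `](s - 1), (s + 1)[%classic u ->
    [set: measurableTypeR R] r -> `|partial1of2 f u r| <= G r.
  rewrite /= in_itv/= => /andP[u1 u2] _; rewrite dfE normrN.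
  apply: (le_trans (psi_integrand_le _ _ _ t0)).
  apply: ler_wpM2r; first by rewrite invr_ge0 ltW// shrink_den.
  apply: ler_wpM2l; first by rewrite exprn_ge0// ltW// kappa_gt0.
  rewrite ler_expR; apply: ler_wpM2l; first by rewrite ltW// kappa_gt0.
  have -> : u = s + (u - s) by ring.
  apply: (le_trans (ler_normD _ _)); rewrite lerD2l ler_norml; apply/andP; split; lra.
have D := @derivable_under_integral R _ _ leb f [set: measurableTypeR R] measurableT
  s (s - 1) (s + 1) Is (fun u _ => intf u) (fun u r _ _ => der u r) G G0 intG Gub.
have E := @differentiation_under_integral R _ _ leb f [set: measurableTypeR R] measurableT
  s (s - 1) (s + 1) Is (fun u _ => intf u) (fun u r _ _ => der u r) G G0 intG Gub.
apply: DeriveDef; first exact: D.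
rewrite -derive1E E /psi -mulN1r -RintegralZl//; last exact: psi_integrable.
by apply: eq_Rintegral => r _; rewrite dfE /f' mulN1r.
Qed.

End GaussianIntegrals.

Section MeasurableNorm3.
Context {d : measure_display} {T : measurableType d} {R : realType}.

Lemma measurable_fun_invr_ge0 (f : T -> R) : (forall x, 0 <= f x) ->
  measurable_fun setT f -> measurable_fun setT (fun x => (f x)^-1).
Proof.
move=> f0 mf; rewrite (_ : (fun x => _) = (fun x => f x `^ (-1))); last first.
  by apply/funext => x; rewrite powR_inv1.
exact: measurable_fun_powR.
Qed.

(** Writing 1 / f as f / f^2 reduces to the nonnegative case; both sides are 0 where f vanishes. *)
Lemma measurable_fun_invr (f : T -> R) :
  measurable_fun setT f -> measurable_fun setT (fun x => (f x)^-1).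
Proof.
move=> mf; rewrite (_ : (fun x => _) = (fun x => f x * (f x ^+ 2)^-1)); last first.
  apply/funext => x; have [->|fx0] := eqVneq (f x) 0; first by rewrite invr0 mul0r.
  by rewrite expr2 invfM mulVKf.
apply: measurable_funM => //; apply: measurable_fun_invr_ge0; last by mfun.
by move=> x; exact: sqr_ge0.
Qed.

Lemma measurable_norm3 (f : T -> space3 (measurableTypeR R)) :
  measurable_fun setT f -> measurable_fun setT (fun z => norm3 (f z)).
Proof. by move=> mf; rewrite /norm3; mfun. Qed.

Lemma measurable_norm3B (f g : T -> space3 (measurableTypeR R)) :
  measurable_fun setT f -> measurable_fun setT g ->
  measurable_fun setT (fun z => norm3 (f z - g z)).
Proof.
move=> mf mg.
rewrite (_ : (fun z => _) = (fun z => Num.sqrt (((f z).1.1 - (g z).1.1) ^+ 2 +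
  ((f z).1.2 - (g z).1.2) ^+ 2 + ((f z).2 - (g z).2) ^+ 2))); last by [].
by mfun.
Qed.

End MeasurableNorm3.

Ltac mfun3 := mfun; repeat (match goal with
  | |- measurable_fun _ (fun x => norm3 (_ - _)%R) => apply: measurable_norm3B
  | |- measurable_fun _ (fun x => norm3 _) => apply: measurable_norm3
  | |- measurable_fun _ (fun x => (_)^-1%R) => apply: measurable_fun_invr
  end; mfun).

Ltac nneg := repeat match goal with
  | H : is_true (0 <= ?x)%R |- is_true (0 <= ?x)%R => exact: H
  | H : is_true (0 < ?x)%R |- is_true (0 <= ?x)%R => exact: (ltW H)
  | |- is_true (0 <= _ ^+ 2)%R => exact: sqr_ge0
  | |- is_true (0 <= _ ^+ _)%R => apply: exprn_ge0
  | |- is_true (0 <= _ * _)%R => apply: mulr_ge0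
  | |- is_true (0 <= _ + _)%R => apply: addr_ge0
  | |- is_true (0 <= _^-1)%R => rewrite invr_ge0
  | |- is_true (0 <= expR _)%R => exact: expR_ge0
  | |- is_true (0 <= Num.sqrt _)%R => exact: sqrtr_ge0
  | |- is_true (0 <= pi)%R => exact: pi_ge0
  | |- is_true (0 <= `|_|)%R => exact: normr_ge0
  | |- is_true (0 <= _%:R)%R => exact: ler0n
  end.

(** * The kernel of the heat semigroup composed with the Leray projection *)

Section OseenKernel.
Context {R : realType}.
Local Notation leb := (@lebesgue_measure R).
Local Notation leb3 := (@leb3 R).
Implicit Types (x y : space3 R) (tau s : R) (i j k : 'I_3).

Lemma norm3_ge0 x : 0 <= norm3 x.
Proof. exact: sqrtr_ge0. Qed.

Lemma norm3_eq0 x : norm3 x = 0 -> x = 0.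
Proof.
move=> x0; have := norm3_sq x; rewrite x0 expr0n/= => /esym/eqP.
rewrite paddr_eq0 ?addr_ge0 ?sqr_ge0// paddr_eq0 ?sqr_ge0// !sqrf_eq0.
by case: x {x0} => [[a b] c]/= /andP[/andP[/eqP-> /eqP->] /eqP->].
Qed.

Lemma norm3B x y : norm3 (x - y) = norm3 (y - x).
Proof. by congr Num.sqrt; rewrite /=; ring. Qed.

Lemma heat_kernelE tau x : 0 < tau ->
  heat_kernel tau x =
  Num.sqrt (kappa tau / pi) ^+ 3 * expR (- (kappa tau * norm3 x ^+ 2)).
Proof.
move=> t0; have p0 : 0 < 4 * pi * tau by rewrite !mulr_gt0// pi_gt0.
rewrite /heat_kernel; congr (_ * expR (- _)); last by rewrite mulrC.
have -> : - (3 / 2) = 2^-1 * (- 3%:R) :> R by lra.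
rewrite powRrM powR12_sqrt ?ltW// powRN powR_mulrn ?sqrtr_ge0//.
rewrite -exprVn -sqrtrV ?ltW//; congr (Num.sqrt _ ^+ 3).
have := gt_eqF (pi_gt0 R); rewrite /kappa; move: (@pi R) => P P0.
by field; rewrite P0 (gt_eqF t0).
Qed.

Lemma integral_heat_kernel tau x : 0 < tau ->
  (\int[leb3]_y (heat_kernel tau (x - y))%:E = 1)%E.
Proof.
move=> t0; have k0 := kappa_gt0 t0.
pose c := Num.sqrt (kappa tau / pi) ^+ 3.
transitivity (\int[leb3]_y (c%:E * (expR (- (kappa tau * norm3 (y - x) ^+ 2 + 0)))%:E))%E.
  by apply: eq_integralT => y; rewrite heat_kernelE// norm3B addr0 EFinM.
rewrite ge0_integralZl//.
- rewrite integral_gauss3// oppr0 expR0 mulr1 -EFinM /c -exprMn -sqrtrM.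
    by rewrite mulrA divfK ?gt_eqF ?pi_gt0// divff ?gt_eqF// sqrtr1 expr1n.
  by rewrite divr_ge0 ?pi_ge0// ltW.
- by mfun3.
- by rewrite lee_fin exprn_ge0 ?sqrtr_ge0.
Qed.

(** The factor 1 / (4 pi) of the Newton kernel times the 1 / sqrt pi of [invr_sqrt_gauss]. *)
Definition newton_const : R := (4 * pi * Num.sqrt pi)^-1.

Lemma newton_const_gt0 : 0 < newton_const.
Proof. by rewrite invr_gt0 !mulr_gt0 ?sqrtr_gt0 ?pi_gt0. Qed.

(** At the origin the identity fails: the integral is infinite, whereas [newton_kernel] is 0 there
    since 0 has inverse 0. *)
Lemma newton_kernel_gauss x : x != 0 ->
  ((newton_kernel x)%:E =
    newton_const%:E * \int[leb]_r (expR (- (norm3 x ^+ 2 * r ^+ 2)))%:E)%E.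
Proof.
move=> x0; have n0 : 0 < norm3 x.
  rewrite lt_neqAle norm3_ge0 andbT eq_sym.
  by apply: contra x0 => /eqP/norm3_eq0 ->.
have := @invr_sqrt_gauss R (norm3 x ^+ 2) (exprn_gt0 2 n0).
rewrite sqrtr_sqr gtr0_norm// => h.
have -> : newton_const = (4 * pi)^-1 * (Num.sqrt pi)^-1 by rewrite /newton_const invfM.
by rewrite EFinM -muleA -h -EFinM /newton_kernel invfM.
Qed.

(* Complete the square in [r^2 |x-y|^2 + kappa |y|^2]. *)
Lemma heat_kernel_gauss tau x (r : R) : 0 < tau ->
  (\int[leb3]_y (expR (- (norm3 (x - y) ^+ 2 * r ^+ 2)) * heat_kernel tau y)%:E =
    (shrink tau r ^+ 3 * expR (- (freq tau r ^+ 2 * norm3 x ^+ 2)))%:E)%E.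
Proof.
move=> t0; have k0 := kappa_gt0 t0.
have rk : 0 < r ^+ 2 + kappa tau by rewrite ltr_wpDl ?sqr_ge0.
have rkE : r ^+ 2 + kappa tau = (1 + 4 * tau * r ^+ 2) / (4 * tau).
  by rewrite /kappa; field; rewrite (gt_eqF t0).
(* The quadratic form in y is minimal at y = q x, with minimum freq^2 |x|^2. *)
pose q : R := r ^+ 2 / (r ^+ 2 + kappa tau).
pose m : space3 R := (q * x.1.1, q * x.1.2, q * x.2).
pose c := Num.sqrt (kappa tau / pi) ^+ 3.
have fE : freq tau r ^+ 2 = r ^+ 2 * kappa tau / (r ^+ 2 + kappa tau).
  rewrite freq_sq// rkE /kappa; have := gt_eqF (shrink_den r t0).
  set D := 1 + _ => D0; field; rewrite (gt_eqF t0) D0 //.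
transitivity (\int[leb3]_y (c%:E * (expR (- ((r ^+ 2 + kappa tau) * norm3 (y - m) ^+ 2 +
    freq tau r ^+ 2 * norm3 x ^+ 2)))%:E))%E.
  apply: eq_integralT => y; rewrite heat_kernelE// -EFinM; congr EFin.
  rewrite mulrCA -expRD; congr (_ * expR _).
  rewrite fE !norm3_sq/= /q; field.
  by rewrite gt_eqF.
rewrite ge0_integralZl//.
- rewrite integral_gauss3// -EFinM mulrA /c -exprMn -sqrtrM; last first.
    by rewrite divr_ge0 ?pi_ge0// ltW.
  congr (_ ^+ 3 * _)%:E; rewrite /shrink -sqrtrV; last by rewrite ltW// shrink_den.
  congr Num.sqrt; rewrite rkE /kappa; have := gt_eqF (shrink_den r t0).
  set D := 1 + _ => D0; have := gt_eqF (pi_gt0 R); move: (@pi R) => P P0.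
  by field; rewrite P0 D0 (gt_eqF t0).
- by mfun3.
- by rewrite lee_fin exprn_ge0 ?sqrtr_ge0.
Qed.

(** Serves to discard the singular point y = x of the Newton kernel: a whole plane through it is
    null directly by the product structure. *)
Lemma leb3_plane (a : R) : leb3 ([set: R * R] `*` [set a]) = 0%E.
Proof.
rewrite /Defs.leb3.
rewrite (@product_measure1E _ _ _ _ R (leb \x leb)%E leb [set: R * R] [set a])//.
by rewrite [X in (_ * X)%E](_ : _ = 0%E) ?mule0//; exact: lebesgue_measure_set1.
Qed.

(** After Tonelli the inner integral over y is a convolution of two Gaussians, known by
    [heat_kernel_gauss]. The resulting formula holds at every x, the origin included. *)
Lemma newton_heat tau x : 0 < tau ->
  convol newton_kernel (heat_kernel tau) x = newton_const * psi 0 tau (norm3 x ^+ 2).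
Proof.
move=> t0.
pose H (z : space3 (measurableTypeR R) * measurableTypeR R) : \bar R :=
  (newton_const * (expR (- (norm3 (x - z.1) ^+ 2 * z.2 ^+ 2)) * heat_kernel tau z.1))%:E.
have mhk : measurable_fun [set: space3 (measurableTypeR R)]
    (fun y : space3 (measurableTypeR R) => heat_kernel tau y).
  by rewrite /heat_kernel /norm3; mfun.
have hk0 y : 0 <= heat_kernel tau y by rewrite mulr_ge0 ?powR_ge0 ?expR_ge0.
have nc0 := ltW newton_const_gt0.
have mH : measurable_fun setT H.
  rewrite /H; mfun.
    by mfun3.
  by apply: (@measurableT_comp _ _ _ _ _ _ _ _ fst mhk measurable_fst).
have H0 z : (0 <= H z)%E.
  by rewrite lee_fin; apply: mulr_ge0 => //; apply: mulr_ge0 => //; exact: expR_ge0.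
have E1 : (\int[leb3]_y (newton_kernel (x - y) * heat_kernel tau y)%:E =
    \int[leb3]_y \int[leb]_r H (y, r))%E.
  apply: ge0_ae_eq_integral => //.
  - rewrite /newton_kernel; apply: measurable_fun_EFin; apply: measurable_funM => //.
    apply: measurable_fun_invr_ge0; last by mfun3.
    by move=> y; rewrite !mulr_ge0 ?norm3_ge0 ?pi_ge0.
  - exact: (@measurable_fun_fubini_tonelli_F _ _ _ _ R leb H mH H0).
  - move=> y _; rewrite lee_fin mulr_ge0// invr_ge0 mulr_ge0 ?norm3_ge0//.
    by rewrite mulr_ge0// pi_ge0.
  - by move=> y _; exact: integral_ge0.
  - exists ([set: R * R] `*` [set x.2]); split.
    + by apply: measurableX.
    + exact: leb3_plane.
    + move=> y /= h; split => //; apply: contrapT => yx; apply: h => _.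
      rewrite EFinM newton_kernel_gauss; last first.
        by apply/eqP => xy; apply: yx; have := congr1 snd xy => /= /subr0_eq ->.
      rewrite /H/=; under [RHS]eq_integral do rewrite EFinM.
      rewrite [RHS]ge0_integralZl//.
      * rewrite -muleA; congr (_ * _)%E; rewrite -ge0_integralZr//.
          by mfun.
        by rewrite lee_fin.
      * by mfun.
      * by move=> r _; rewrite lee_fin; apply: mulr_ge0 => //; exact: expR_ge0.
rewrite /convol /Rintegral E1.
have -> : (\int[leb3]_y \int[leb]_r H (y, r) = \int[leb]_r \int[leb3]_y H (y, r))%E.
  exact: (@fubini_tonelli _ _ _ _ R (@leb3s R) leb H mH H0).
rewrite /psi -RintegralZl//; last exact: psi_integrable.
congr fine; apply: eq_integralT => r; rewrite /H/=.
under eq_integral do rewrite EFinM.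
rewrite ge0_integralZl//.
- by rewrite heat_kernel_gauss// -EFinM muln0 expr0 mulr1.
- by apply: measurable_fun_EFin; apply: measurable_funM; [mfun3|exact: mhk].
- by move=> y _; rewrite lee_fin; apply: mulr_ge0 => //; exact: expR_ge0.
Qed.

Definition co i x : R :=
  if i == 0%N :> nat then x.1.1 else if i == 1%N :> nat then x.1.2 else x.2.

(** Reduces partial derivatives to calculus in one variable, so that no total differentiability on
    triples has to be established. *)
Lemma is_derive_line (F : space3 R -> R) x (v : space3 R) (l : R) :
  is_derive (0 : R) (1 : R) (fun h : R => F (h *: v + x)) l -> is_derive x v F l.
Proof.
move=> [d1 d2].
have E : (fun h : R => h^-1 *: ((F \o shift x) (h *: v) - F x)) =
    (fun h : R => h^-1 *: (((fun h : R => F (h *: v + x)) \o shift (0 : R)) (h *: (1 : R)) -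
      F ((0 : R) *: v + x))).
  apply/funext => h /=; rewrite scale0r add0r addr0.
  by rewrite /GRing.scale/= mulr1.
by split; [rewrite /derivable E|rewrite /derive E].
Qed.

Lemma co_line i j x (h : R) : co j (h *: base3 i + x) = (i == j)%:R * h + co j x.
Proof.
rewrite /co /base3; case: i => [[|[|[|]]]//= i3]; case: j => [[|[|[|]]]//= j3];
  by rewrite /GRing.scale/= -?val_eqE/= ?mulr1 ?mulr0 ?mul1r ?mul0r.
Qed.

Lemma norm3_co x : norm3 x ^+ 2 = \sum_j co j x ^+ 2.
Proof. by rewrite norm3_sq !big_ord_recr big_ord0/= add0r. Qed.

Lemma norm3_line i x (h : R) :
  norm3 (h *: base3 i + x) ^+ 2 = h ^+ 2 + 2 * co i x * h + norm3 x ^+ 2.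
Proof.
rewrite !norm3_co; under eq_bigr do rewrite co_line sqrrD.
rewrite !big_split/= (bigD1 i)//= eqxx mul1r big1 ?addr0; last first.
  by move=> j /negPf ji; rewrite eq_sym ji mul0r expr0n.
congr (_ + _ + _); rewrite (bigD1 i)//= eqxx mul1r big1 ?addr0; last first.
  by move=> j /negPf ji; rewrite eq_sym ji !mul0r.
by rewrite -mulr_natl; ring.
Qed.

Lemma is_derive_co i j x : is_derive x (base3 i) (co j) ((i == j)%:R : R).
Proof.
apply: is_derive_line; under eq_fun do rewrite co_line.
by apply: is_derive_eq; rewrite /GRing.scale/= mulr1 addr0.
Qed.

(** Along a coordinate line |x|^2 is a quadratic polynomial. Using |x|^2 rather than |x| avoids the
    singularity of the norm at 0. *)
Lemma is_derive_radial i x (f : R -> R) (l : R) :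
  is_derive (norm3 x ^+ 2) (1 : R) f l ->
  is_derive x (base3 i) (fun y => f (norm3 y ^+ 2)) (2 * co i x * l).
Proof.
move=> df; apply: is_derive_line; under eq_fun do rewrite norm3_line.
pose g (h : R) : R := h ^+ 2 + 2 * co i x * h + norm3 x ^+ 2.
have dg : is_derive (0 : R) (1 : R) g (2 * co i x).
  rewrite /g; apply: is_derive_eq; rewrite /GRing.scale/=; ring.
have df' : is_derive (g 0) (1 : R) f l.
  by rewrite /g expr0n/= mulr0 !add0r.
have := @is_derive1_comp R f g 0 _ _ df' dg.
by rewrite mulrC.
Qed.

Lemma pdE i (f g : space3 R -> R) :
  (forall x, is_derive x (base3 i) f (g x)) -> pd i f = g.
Proof. by move=> h; apply/funext => x; exact: (@derive_val _ _ _ _ _ _ _ (h x)). Qed.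

Local Notation nc := newton_const.

Let psir m tau : space3 R -> R := fun x => psi m tau (norm3 x ^+ 2).

Lemma is_derive_psir m i tau x : 0 < tau ->
  is_derive x (base3 i) (psir m tau) (- (2 * co i x * psir m.+1 tau x)).
Proof.
move=> t0; rewrite -mulrN; apply: is_derive_radial.
exact: is_derive_psi.
Qed.

Lemma is_derive_heat_kernel k tau x : 0 < tau ->
  is_derive x (base3 k) (heat_kernel tau)
    (- (2 * kappa tau * co k x * heat_kernel tau x)).
Proof.
move=> t0; have -> : heat_kernel tau = fun y =>
    Num.sqrt (kappa tau / pi) ^+ 3 * expR (- (kappa tau * norm3 y ^+ 2)).
  by apply/funext => y; rewrite heat_kernelE.
have dk : is_derive (norm3 x ^+ 2) (1 : R) (fun s : R => - (kappa tau * s)) (- kappa tau).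
  by apply: is_derive_eq; rewrite /GRing.scale/= mulr1.
have dc := @is_derive1_comp R expR (fun s : R => - (kappa tau * s)) _ _ _ (is_derive_expR _) dk.
have dr := @is_derive_radial k x (fun s => expR (- (kappa tau * s))) _ dc.
apply: (@is_derive_eq _ _ _ _ _ _ _ _ (is_deriveZ (Num.sqrt (kappa tau / pi) ^+ 3) dr)).
by rewrite /GRing.scale/=; ring.
Qed.

Lemma pd_convol_newton k tau : 0 < tau ->
  pd k (convol newton_kernel (heat_kernel tau)) =
  fun x => - (2 * nc * co k x * psir 1 tau x).
Proof.
move=> t0; apply: pdE => x.
have -> : convol newton_kernel (heat_kernel tau) = fun y => nc * psir 0 tau y.
  by apply/funext => y; rewrite newton_heat.
apply: (@is_derive_eq _ _ _ _ _ _ _ _ (is_deriveZ nc (is_derive_psir 0 k x t0))).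
by rewrite /GRing.scale/=; ring.
Qed.

(** The second summand is the Hessian of the Newton potential of the heat kernel: each derivative of
    psi in |x|^2 changes its sign and raises its order, which gives 4 x_i x_j psi_2 - 2 delta_ij
    psi_1. *)
Lemma oseenE tau i j : 0 < tau ->
  oseen tau i j = fun x => (i == j)%:R * heat_kernel tau x +
    nc * (4 * co i x * co j x * psir 2 tau x - 2 * (i == j)%:R * psir 1 tau x).
Proof.
move=> t0; apply/funext => x.
rewrite /oseen /leray !mxE; congr (_ + _).
  by rewrite eqxx /= mulrC.
have -> : (fun y => \sum_k pd k (convol newton_kernel
    (fun z => (heat_kernel tau z *: ('e_j : 'rV[R]_3)) 0 k)) y) =
    (fun y => - (2 * nc * (co j y * psir 1 tau y))).
  (* Only the j-th component of the column is nonzero, so the divergence has a single term. *)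
  apply/funext => y; rewrite (bigD1 j)//= big1 ?addr0.
    have -> : (fun z => (heat_kernel tau z *: ('e_j : 'rV[R]_3)) 0 j) = heat_kernel tau :> (space3 R -> R).
      by apply/funext => z; rewrite !mxE !eqxx mulr1.
    by rewrite pd_convol_newton//; ring.
  move=> k kj.
  have -> : (fun z => (heat_kernel tau z *: ('e_j : 'rV[R]_3)) 0 k) = (fun _ => 0) :> (space3 R -> R).
    by apply/funext => z; rewrite !mxE (negPf kj) andbF mulr0.
  have -> : convol newton_kernel (fun _ : space3 R => 0) = cst (0 : R) :> (space3 R -> R).
    apply/funext => z; rewrite /convol /Rintegral integral0_eq//.
    by move=> w _; rewrite mulr0.
  by rewrite /pd derive_cst.
have D := is_deriveZ (- (2 * nc)) (is_deriveM (is_derive_co i j x) (is_derive_psir 1 i x t0)).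
rewrite (_ : (fun y => - (2 * nc * (co j y * psir 1 tau y))) =
  (fun y => - (2 * nc) * (co j y * psir 1 tau y))); last by apply/funext => y; ring.
apply: (eq_trans (@derive_val _ _ _ _ _ _ _ D)).
by rewrite /GRing.scale/=; ring.
Qed.

(** One more derivative of [oseenE]: the cubic term comes from psi_2' = - psi_3, the symmetric
    linear one from both differentiating x_i x_j and psi_1' = - psi_2. *)
Definition kern i j k tau x : R :=
  - ((i == j)%:R * (2 * kappa tau * co k x * heat_kernel tau x)) +
  nc * (4 * ((i == j)%:R * co k x + (k == i)%:R * co j x + (k == j)%:R * co i x) *
          psi 2 tau (norm3 x ^+ 2) -
        8 * co i x * co j x * co k x * psi 3 tau (norm3 x ^+ 2)).

Lemma pd_oseen tau i j k : 0 < tau -> pd k (oseen tau i j) = kern i j k tau.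
Proof.
move=> t0; rewrite oseenE//; apply: pdE => x.
have D1 := is_deriveZ ((i == j)%:R : R) (is_derive_heat_kernel k x t0).
have D2 := is_deriveM (is_deriveM (is_derive_co k i x) (is_derive_co k j x))
  (is_derive_psir 2 k x t0).
have D3 := is_deriveZ (- (2 * (i == j)%:R) : R) (is_derive_psir 1 k x t0).
have D4 := is_deriveZ nc (is_deriveD (is_deriveZ 4 D2) D3).
have D := is_deriveD D1 D4.
rewrite (_ : (fun x0 => _) = (fun y => (i == j)%:R * heat_kernel tau y +
    nc * (4 * (co i y * co j y * psir 2 tau y) +
      - (2 * (i == j)%:R) * psir 1 tau y))); last by apply/funext => y; ring.
refine (@is_derive_eq _ _ _ _ _ _ _ _ D _).
by rewrite /kern /psir !fctE /GRing.scale/=; ring.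
Qed.

Lemma measurable_kern i j k : measurable_fun [set: space3 (measurableTypeR R) * measurableTypeR R]
  (fun z : space3 (measurableTypeR R) * measurableTypeR R => kern i j k z.2 z.1).
Proof.
have mco (l : 'I_3) : measurable_fun [set: space3 (measurableTypeR R) * measurableTypeR R]
    (fun z : space3 (measurableTypeR R) * measurableTypeR R => co l z.1).
  rewrite /co; case: (l == 0%N :> nat); first by mfun.
  by case: (l == 1%N :> nat); mfun.
have mpsi m : measurable_fun [set: space3 (measurableTypeR R) * measurableTypeR R]
    (fun z : space3 (measurableTypeR R) * measurableTypeR R => psi m z.2 (norm3 z.1 ^+ 2)).
  apply: (@measurableT_comp _ _ _ _ _ _
    (fun w : measurableTypeR R * measurableTypeR R => psi m w.1 w.2) _
    (fun z : space3 (measurableTypeR R) * measurableTypeR R => (z.2, norm3 z.1 ^+ 2))).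
    exact: measurable_psi.
  by mfun3.
by rewrite /kern /heat_kernel /kappa; mfun3; first [exact: mco|exact: mpsi].
Qed.

Lemma co_le i x : `|co i x| <= norm3 x.
Proof.
rewrite -(ger0_norm (norm3_ge0 x)) -ler_sqr ?nnegrE// !real_normK ?num_real//.
rewrite norm3_co (bigD1 i)//= lerDl sumr_ge0// => j _.
exact: sqr_ge0.
Qed.

(** Half of the Gaussian absorbs the factor z, as z <= 1 + z^2 / 2 <= exp (z^2 / 2). *)
Lemma gauss_moment1 (z : R) : 0 <= z -> z * expR (- z ^+ 2) <= expR (- (z ^+ 2 / 2)).
Proof.
move=> z0; have -> : - z ^+ 2 = - (z ^+ 2 / 2) + - (z ^+ 2 / 2) by lra.
rewrite expRD mulrA ler_piMl ?expR_ge0// expRN ler_pdivrMr ?expR_gt0// mul1r.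
by apply: le_trans (expR_ge1Dx _); have := sqr_ge0 (z - 1); rewrite sqrrB1; lra.
Qed.

Lemma gauss_moment3 (z : R) : 0 <= z -> z ^+ 3 * expR (- z ^+ 2) <= 8 * expR (- (z ^+ 2 / 2)).
Proof.
move=> z0; have -> : - z ^+ 2 = - (z ^+ 2 / 4) + - (z ^+ 2 / 4) + - (z ^+ 2 / 2) by lra.
rewrite expRD mulrA ler_wpM2r ?expR_ge0// expRD -expr2 expRN exprVn.
rewrite ler_pdivrMr ?exprn_gt0 ?expR_gt0//.
have h := expR_ge1Dx (z ^+ 2 / 4).
apply: (@le_trans _ _ (8 * (1 + z ^+ 2 / 4) ^+ 2)).
  (* It remains to see z^3 <= 8 (1 + z^2 / 4)^2, that is w^3 <= (1 + w^2)^2. *)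
  pose w := z / 2; have -> : z = 2 * w by rewrite /w; lra.
  have w0 : 0 <= w by rewrite /w; lra.
  rewrite -subr_ge0.
  have -> : 8 * (1 + (2 * w) ^+ 2 / 4) ^+ 2 - (2 * w) ^+ 3 =
    8 * (1 + w ^+ 2 * (2 - w + w ^+ 2)) by field.
  have h1 : 0 <= 2 - w + w ^+ 2 by have := sqr_ge0 (w - 1); rewrite sqrrB1; lra.
  by rewrite mulr_ge0// addr_ge0// mulr_ge0// sqr_ge0.
by rewrite ler_wpM2l// lerXn2r ?nnegrE ?expR_ge0 ?addr_ge0 ?divr_ge0 ?sqr_ge0.
Qed.

(** Here 76 = 12 + 8 * 8: the linear term of [kern] has coefficient at most 12, and the cubic one
    has 8, times the 8 of [gauss_moment3]. The integrals actually give half of this constant, since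
    sqrt kappa = 1 / (2 sqrt tau). *)
Definition kern_const : R :=
  2 * Num.sqrt 2 ^+ 3 + 76 * newton_const * Num.sqrt (2 * pi) ^+ 3 * pi.

Lemma kern_const_gt0 : 0 < kern_const.
Proof.
have nc0 := newton_const_gt0; rewrite /kern_const; apply: ltr_wpDr; first by nneg.
by rewrite mulr_gt0// exprn_gt0// sqrtr_gt0.
Qed.

(* [mjh] dominates the heat kernel part of [kern], and [mjr] the integrand of
   its Newtonian part; both are Gaussian in [n = |x|]. *)
Let mjr tau (r n : R) : R :=
  76 * nc * (shrink tau r ^+ 3 * (`|freq tau r| ^+ 3 * expR (- ((freq tau r ^+ 2 / 2) * n ^+ 2)))).

Let mjh tau (n : R) : R := 2 * Num.sqrt (kappa tau / pi) ^+ 3 * Num.sqrt (kappa tau) *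
  expR (- ((kappa tau / 2) * n ^+ 2)).

Lemma psi_ge0 (m : nat) tau s : 0 < tau -> 0 <= psi m tau s.
Proof.
move=> t0; apply: Rintegral_ge0 => r _; have b0 := shrink_gt0 r t0.
by rewrite exprM; nneg.
Qed.

(** In psi_2 and psi_3 every factor |x| is paired with a factor |freq| and absorbed by half of the
    Gaussian. What is left over is |freq|^3 in both cases, exactly what integration over R^3 will
    cancel. *)
Lemma kern_le i j k tau x : 0 < tau ->
  (`|kern i j k tau x|%:E <= (mjh tau (norm3 x))%:E + \int[leb]_r (mjr tau r (norm3 x))%:E)%E.
Proof.
move=> t0; set n := norm3 x; have n0 : 0 <= n by exact: norm3_ge0.
have k0 := kappa_gt0 t0; have nc0 := newton_const_gt0.
have dl (b : bool) : `|b%:R : R| <= 1 by case: b; rewrite ?normr1 ?normr0.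
have dl0 (b : bool) : 0 <= `|b%:R : R| by [].
have p2 := psi_ge0 2 (n ^+ 2) t0; have p3 := psi_ge0 3 (n ^+ 2) t0.
have ci := co_le i x; have cj := co_le j x; have ck := co_le k x.
have dM (b : bool) (a : R) : `|a| <= n -> `|b%:R * a| <= n.
  by move=> an; rewrite normrM -[leRHS]mul1r ler_pM.
have H1 : `|(i == j)%:R * (2 * kappa tau * co k x * heat_kernel tau x)| <= mjh tau n.
  rewrite heat_kernelE// -/n /mjh.
  set c := Num.sqrt (kappa tau / pi) ^+ 3; set sk := Num.sqrt (kappa tau).
  have c0 : 0 <= c by rewrite exprn_ge0 ?sqrtr_ge0.
  have sk2 : sk ^+ 2 = kappa tau by rewrite sqr_sqrtr// ltW.
  have sk0 : 0 <= sk by exact: sqrtr_ge0.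
  clearbody c sk.
  have := @gauss_moment1 (sk * n) (mulr_ge0 sk0 n0).
  rewrite exprMn sk2 (mulrAC (kappa tau)) => h.
  apply: (@le_trans _ _ (2 * c * sk * (sk * n * expR (- (kappa tau * n ^+ 2))))); last first.
    by apply: ler_wpM2l => //; rewrite !mulr_ge0.
  rewrite (_ : 2 * c * sk * _ = 1 * (2 * kappa tau * n * (c * expR (- (kappa tau * n ^+ 2))))); last first.
    by rewrite -sk2; ring.
  rewrite normrM; apply: ler_pM => //.
  rewrite !normrM (ger0_norm c0) (ger0_norm (expR_ge0 _)) ger0_norm// (gtr0_norm k0).
  apply: ler_wpM2r; first by rewrite mulr_ge0 ?expR_ge0.
  by apply: ler_wpM2l => //; rewrite mulr_ge0// ltW.
have H2 : `|nc * (4 * ((i == j)%:R * co k x + (k == i)%:R * co j x + (k == j)%:R * co i x) *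
      psi 2 tau (n ^+ 2) - 8 * co i x * co j x * co k x * psi 3 tau (n ^+ 2))| <=
    nc * (12 * n * psi 2 tau (n ^+ 2) + 8 * n ^+ 3 * psi 3 tau (n ^+ 2)).
  rewrite normrM gtr0_norm//; apply: ler_wpM2l; first exact: ltW.
  apply: (le_trans (ler_normB _ _)); apply: lerD.
    rewrite normrM (ger0_norm p2); apply: ler_wpM2r => //.
    rewrite normrM ger0_norm// (_ : 12 * n = 4 * (n + n + n)); last by ring.
    apply: ler_wpM2l => //; apply: (le_trans (ler_normD _ _)); apply: lerD; last exact: dM.
    by apply: (le_trans (ler_normD _ _)); apply: lerD; exact: dM.
  rewrite normrM (ger0_norm p3); apply: ler_wpM2r => //.
  rewrite !normrM ger0_norm// (_ : 8 * n ^+ 3 = 8 * n * n * n); last by ring.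
  by rewrite !ler_pM ?mulr_ge0.
have I2 := @psi_integrable R 2 tau (n ^+ 2) t0; have I3 := @psi_integrable R 3 tau (n ^+ 2) t0.
apply: (@le_trans _ _ ((mjh tau n)%:E +
    (nc * (12 * n * psi 2 tau (n ^+ 2) + 8 * n ^+ 3 * psi 3 tau (n ^+ 2)))%:E)%E).
  rewrite -EFinD lee_fin /kern -/n; apply: (le_trans (ler_normD _ _)).
  by rewrite normrN; apply: lerD.
apply: leeD2l.
have fin m : leb.-integrable [set: measurableTypeR R] (fun r : measurableTypeR R =>
    (shrink tau r ^+ 3 * freq tau r ^+ (2 * m) * expR (- (freq tau r ^+ 2 * n ^+ 2)))%:E).
  exact: psi_integrable.
have psiE m : (psi m tau (n ^+ 2))%:E = (\int[leb]_r (shrink tau r ^+ 3 * freq tau r ^+ (2 * m) *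
    expR (- (freq tau r ^+ 2 * n ^+ 2)))%:E)%E.
  by rewrite /psi /Rintegral fineK//; exact: (integrable_fin_num _ (fin m)).
have -> : (nc * (12 * n * psi 2 tau (n ^+ 2) + 8 * n ^+ 3 * psi 3 tau (n ^+ 2)))%:E =
    ((nc * 12 * n)%:E * (psi 2 tau (n ^+ 2))%:E +
     (nc * 8 * n ^+ 3)%:E * (psi 3 tau (n ^+ 2))%:E)%E.
  by rewrite -!EFinM -EFinD; congr EFin; ring.
rewrite !psiE -!integralZl// -integralD//; [|exact: integrableZl|exact: integrableZl].
apply: ge0_le_integral => //.
- move=> r _; rewrite -!EFinM -EFinD lee_fin.
  by have b0 := shrink_gt0 r t0; rewrite !exprM; nneg.
- by rewrite /freq /shrink; apply: emeasurable_funD; mfun.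
- by rewrite /mjr /freq /shrink; mfun.
move=> r _; rewrite -!EFinM -EFinD lee_fin /mjr.
have b0 := ltW (shrink_gt0 r t0).
move: (shrink tau r) (freq tau r) b0 => b p b0.
have p0 : 0 <= `|p| * n by rewrite mulr_ge0.
have := gauss_moment3 p0; have := gauss_moment1 p0.
rewrite !exprMn real_normK ?num_real// (mulrAC _ (n ^+ 2)).
set e := expR _; set e' := expR _ => h1 h3.
have p3E : 0 <= nc * b ^+ 3 * `|p| ^+ 3 by rewrite !mulr_ge0 ?exprn_ge0// ltW.
have p4 : p ^+ (2 * 2) = `|p| ^+ 4 by rewrite exprM -(real_normK (num_real p)) -exprM.
have p6 : p ^+ (2 * 3) = `|p| ^+ 6 by rewrite exprM -(real_normK (num_real p)) -exprM.
rewrite p4 p6.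
apply: (@le_trans _ _ (nc * b ^+ 3 * `|p| ^+ 3 * (12 * (`|p| * n * e) + 8 * (`|p| ^+ 3 * n ^+ 3 * e)))).
  by rewrite le_eqVlt; apply/orP; left; apply/eqP; ring.
rewrite (_ : 76 * nc * _ = nc * b ^+ 3 * `|p| ^+ 3 * (76 * e')); last by ring.
by apply: ler_wpM2l => //; lra.
Qed.

Lemma integral_gauss3_shift (c : R) x : 0 < c ->
  (\int[leb3]_y (expR (- (c * norm3 (x - y) ^+ 2)))%:E = (Num.sqrt (pi / c) ^+ 3)%:E)%E.
Proof.
move=> c0; have := @integral_gauss3 R c 0 x c0; rewrite oppr0 expR0 mulr1 => <-.
by apply: eq_integralT => y; rewrite addr0 norm3B.
Qed.

(** Integrated over y first, the Gaussian cancels |freq|^3 and leaves a multiple of shrink^3 <= 1 /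
    (1 + 4 tau r^2); the integral of this over r is pi / (2 sqrt tau), whence the power of tau. *)
Lemma kern_L1 i j k tau x : 0 < tau ->
  (\int[leb3]_y `|kern i j k tau (x - y)|%:E <= (kern_const * (Num.sqrt tau)^-1)%:E)%E.
Proof.
move=> t0; have k0 := kappa_gt0 t0; have nc0 := newton_const_gt0.
have mjr0 r n : 0 <= mjr tau r n.
  by rewrite /mjr !mulr_ge0 ?exprn_ge0 ?expR_ge0//; apply: ltW => //; exact: shrink_gt0.
have mjh0 n : 0 <= mjh tau n by rewrite /mjh !mulr_ge0 ?exprn_ge0 ?sqrtr_ge0 ?expR_ge0.
pose H (z : space3 (measurableTypeR R) * measurableTypeR R) : \bar R :=
  (mjr tau z.2 (norm3 (x - z.1)))%:E.
have mH : measurable_fun setT H by rewrite /H /mjr /freq /shrink; mfun3.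
have H0 z : (0 <= H z)%E by rewrite lee_fin.
have mh : measurable_fun [set: space3 (measurableTypeR R)]
    (fun y : space3 (measurableTypeR R) => (mjh tau (norm3 (x - y)))%:E).
  by rewrite /mjh; mfun3.
have mIH : measurable_fun [set: space3 (measurableTypeR R)]
    (fun y : space3 (measurableTypeR R) => \int[leb]_r H (y, r))%E.
  exact: (@measurable_fun_fubini_tonelli_F _ _ _ _ R leb H mH H0).
have mk : measurable_fun [set: space3 (measurableTypeR R)]
    (fun y : space3 (measurableTypeR R) => `|kern i j k tau (x - y)|%:E).
  apply: measurable_fun_EFin; apply: measurable_fun_norm.
  apply: (@measurableT_comp _ _ _ _ _ _
    (fun z : space3 (measurableTypeR R) * measurableTypeR R => kern i j k z.2 z.1) _
    (fun y : space3 (measurableTypeR R) => (x - y, tau))).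
    exact: measurable_kern.
  apply: measurable_fun_pair; last exact: measurable_cst.
  rewrite (_ : (fun y => x - y) = (fun y => (x.1.1 - y.1.1, x.1.2 - y.1.2, x.2 - y.2))); last by [].
  by mfun.
apply: (@le_trans _ _ (\int[leb3]_y ((mjh tau (norm3 (x - y)))%:E + \int[leb]_r H (y, r)))%E).
  apply: ge0_le_integral => //.
  - exact: emeasurable_funD.
  - by move=> y _; exact: kern_le.
rewrite ge0_integralD//; [|by move=> y _; rewrite lee_fin|by move=> y _; exact: integral_ge0].
have -> : (\int[leb3]_y \int[leb]_r H (y, r) = \int[leb]_r \int[leb3]_y H (y, r))%E.
  exact: (@fubini_tonelli _ _ _ _ R (@leb3s R) leb H mH H0).
have sk0 : 0 < Num.sqrt (kappa tau) by rewrite sqrtr_gt0.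
have skE : Num.sqrt (kappa tau) = (2 * Num.sqrt tau)^-1.
  by rewrite sqrtrV ?mulr_ge0 ?ltW// sqrtrM// (_ : 4 = 2 ^+ 2) ?sqrtr_sqr ?ger0_norm//; ring.
have st0 : 0 < Num.sqrt tau by rewrite sqrtr_gt0.
have L1 : (\int[leb3]_y (mjh tau (norm3 (x - y)))%:E =
    (2 * Num.sqrt 2 ^+ 3 * Num.sqrt (kappa tau))%:E)%E.
  rewrite /mjh; under eq_integral do rewrite EFinM.
  rewrite ge0_integralZl//.
  - rewrite integral_gauss3_shift ?divr_gt0// -EFinM; congr EFin.
    have -> : Num.sqrt 2 = Num.sqrt (kappa tau / pi) * Num.sqrt (pi / (kappa tau / 2)) :> R.
      rewrite -sqrtrM ?divr_ge0 ?pi_ge0 ?(ltW k0)//; congr Num.sqrt.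
      have := gt_eqF (pi_gt0 R); move: (@pi R) => P P0.
      by field; rewrite P0 (gt_eqF k0).
    by rewrite exprMn; ring.
  - by mfun3.
have L2 (r : R) : (\int[leb3]_y H (y, r) <=
    (76 * nc * Num.sqrt (2 * pi) ^+ 3 * (1 + 4 * tau * r ^+ 2)^-1)%:E)%E.
  have b0 := ltW (shrink_gt0 r t0); have b3 := shrink3_le r t0.
  have cpos : 0 <= 76 * nc * Num.sqrt (2 * pi) ^+ 3.
    by rewrite !mulr_ge0 ?exprn_ge0 ?sqrtr_ge0// ltW.
  (* If freq = 0 the Gaussian does not decay, but its prefactor vanishes. *)
  have [p0|p0] := eqVneq (freq tau r) 0.
    rewrite integral0_eq; last by move=> y _; rewrite /H /mjr/= p0 normr0 expr0n/= !mul0r !mulr0.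
    by rewrite lee_fin mulr_ge0// invr_ge0 ltW// shrink_den.
  have p20 : 0 < freq tau r ^+ 2 / 2 by rewrite divr_gt0// exprn_even_gt0.
  pose c := 76 * nc * (shrink tau r ^+ 3 * `|freq tau r| ^+ 3).
  have c0 : 0 <= c by rewrite /c !mulr_ge0 ?exprn_ge0// ltW.
  have -> : (\int[leb3]_y H (y, r) =
      c%:E * \int[leb3]_y (expR (- (freq tau r ^+ 2 / 2 * norm3 (x - y) ^+ 2)))%:E)%E.
    rewrite -ge0_integralZl//; last by mfun3.
    by apply: eq_integralT => y; rewrite -EFinM /H /mjr /c/=; congr EFin; ring.
  rewrite integral_gauss3_shift// -EFinM lee_fin.
  have -> : Num.sqrt (pi / (freq tau r ^+ 2 / 2)) = Num.sqrt (2 * pi) / `|freq tau r|.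
    rewrite -sqrtr_sqr -sqrtrV ?sqr_ge0// -sqrtrM ?mulr_ge0 ?pi_ge0//.
    by congr Num.sqrt; field; rewrite p0.
  rewrite (_ : c * _ = 76 * nc * Num.sqrt (2 * pi) ^+ 3 * shrink tau r ^+ 3).
    exact: ler_wpM2l.
  by rewrite /c; field; rewrite normr_eq0 p0.
pose A : R := 2 * Num.sqrt 2 ^+ 3 * Num.sqrt (kappa tau).
pose B : R := 76 * nc * Num.sqrt (2 * pi) ^+ 3 * (pi / Num.sqrt (1 * (4 * tau))).
apply: (@le_trans _ _ (A%:E + B%:E)%E).
  apply: leeD.
    by rewrite le_eqVlt; apply/orP; left; apply/eqP; exact: L1.
  apply: (@le_trans _ _ (\int[leb]_r
      (76 * nc * Num.sqrt (2 * pi) ^+ 3 * (1 + 4 * tau * r ^+ 2)^-1)%:E)%E).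
    apply: ge0_le_integral; [by []|by move=> r _; exact: integral_ge0| | |by move=> r _; exact: L2].
    - exact: (@measurable_fun_fubini_tonelli_G _ _ _ _ R (@leb3s R) H mH H0).
    - by mfun3.
  under eq_integral do rewrite EFinM.
  rewrite ge0_integralZl//.
  - by rewrite (@integral_inv_quadratic R 1 (4 * tau)) ?mulr_gt0.
  - by mfun3.
  - by move=> r _; rewrite lee_fin invr_ge0 ltW// shrink_den.
  - by rewrite lee_fin; nneg.
have s4 : Num.sqrt (1 * (4 * tau)) = 2 * Num.sqrt tau.
  by rewrite mul1r sqrtrM// (_ : 4 = 2 ^+ 2) ?sqrtr_sqr ?ger0_norm//; ring.
rewrite -EFinD lee_fin /A /B skE s4.
have := gt_eqF st0; move: (Num.sqrt tau) st0 => T T0 Tn.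
have kc0 := kern_const_gt0.
rewrite (_ : _ + _ = kern_const * T^-1 / 2); last first.
  by rewrite /kern_const; field; rewrite Tn.
by rewrite ler_pdivrMr// ler_peMr ?ler1n//; nneg.
Qed.

End OseenKernel.

(** * Joint measurability of the kernels *)

Section MeasurableKernels.
Context {d : measure_display} {T : measurableType d} {R : realType}.
Local Notation TT := (measurableTypeR R).
Local Notation X := (space3 (measurableTypeR R)).
Implicit Types (p q : T -> X) (r : T -> TT).

Lemma measurable_sub3 p q :
  measurable_fun setT p -> measurable_fun setT q ->
  measurable_fun setT (fun w => (p w - q w : X)).
Proof.
move=> mp mq; rewrite (_ : (fun w => _) = (fun w => ((p w).1.1 - (q w).1.1,
  (p w).1.2 - (q w).1.2, (p w).2 - (q w).2))); last by [].
by mfun.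
Qed.

Lemma measurable_kern_comp (i j k : 'I_3) p r :
  measurable_fun setT p -> measurable_fun setT r ->
  measurable_fun setT (fun w => kern i j k (r w) (p w)).
Proof.
move=> mp mr; apply: (@measurableT_comp _ _ _ _ _ _
  (fun z : X * TT => kern i j k z.2 z.1) _ (fun w => (p w, r w))).
  exact: measurable_kern.
exact: measurable_fun_pair.
Qed.

Lemma measurable_heat_kernel_comp p r :
  measurable_fun setT p -> measurable_fun setT r ->
  measurable_fun setT (fun w => heat_kernel (r w) (p w)).
Proof. by move=> mp mr; rewrite /heat_kernel; mfun3. Qed.

Lemma measurable_Rintegral_leb3 (f : T -> X -> R) :
  measurable_fun setT (fun z : T * X => f z.1 z.2) ->
  measurable_fun setT (fun x => \int[@leb3 R]_y f x y).
Proof. exact: (@measurable_fun_Rintegral _ _ _ _ _ (@leb3s R) f). Qed.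

End MeasurableKernels.

(** * Essential suprema and almost everywhere bounds *)

Section AlmostEverywhere.
Context {d : measure_display} {T : measurableType d} {R : realType}.
Variable mu : {measure set T -> \bar R}.

Lemma measurable_fun_abse (D : set T) (f : T -> \bar R) :
  measurable_fun D f -> measurable_fun D (fun x => `|f x|%E).
Proof. by move=> mf; exact: measurableT_comp. Qed.

Lemma ae_impl (P Q : T -> Prop) : (forall x, P x -> Q x) ->
  {ae mu, forall x, P x} -> {ae mu, forall x, Q x}.
Proof. by move=> PQ; apply: filterS. Qed.

Lemma ae_and (P Q : T -> Prop) :
  {ae mu, forall x, P x} -> {ae mu, forall x, Q x} -> {ae mu, forall x, P x /\ Q x}.
Proof. exact: filterI. Qed.

(** The norm is an essential supremum if the space has positive measure and 0 otherwise; hence the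
    case split here, and the condition 0 <= D in the converse. *)
Lemma Lnormy_le_ae (f : T -> R) (D : R) :
  ('N[mu]_+oo[EFin \o f] <= D%:E)%E -> {ae mu, forall x, `|f x| <= D}.
Proof.
rewrite Lnorm.unlock /=; case: ifPn => [mu0 /ess_supP|].
  by apply: ae_impl => x /=; rewrite lee_fin.
by rewrite -leNgt measure_le0 => /eqP mu0 _; exists setT.
Qed.

Lemma Lnormy_ae_le (f : T -> R) (D : R) : 0 <= D ->
  {ae mu, forall x, `|f x| <= D} -> ('N[mu]_+oo[EFin \o f] <= D%:E)%E.
Proof.
move=> D0 fD; rewrite Lnorm.unlock /=; case: ifPn => mu0; last by rewrite lee_fin.
by apply/ess_supP; apply: ae_impl fD => x /=; rewrite lee_fin.
Qed.

End AlmostEverywhere.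

(** * Bounds for the operators *)

Section Operators.
Context {R : realType}.
Local Notation leb := (@lebesgue_measure R).
Local Notation leb3 := (@leb3 R).
Local Notation leb4 := (@leb4 R).
Local Notation TT := (measurableTypeR R).
Local Notation X := (space3 (measurableTypeR R)).
Implicit Types (t s tau l D : R) (x y : space3 R) (g h : mfield_t R)
  (u v : vfield_t R) (w : vfield R).

Definition jmeasurable_v v : Prop :=
  forall i, measurable_fun [set: X * TT] (fun z : X * TT => v z.2 z.1 0 i).

Definition jmeasurable_m g : Prop :=
  forall i j, measurable_fun [set: X * TT] (fun z : X * TT => g z.2 z.1 i j).

(* As [pd] is a total operator, [heat_leray_div (t - s)] is measurable in s only
   where t - s > 0 a priori, whereas [slice] is jointly measurable everywhere. *)
Definition slice (i : 'I_3) g t x s : R :=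
  \sum_j \sum_k \int[leb3]_y (kern i j k (t - s) (x - y) * g s y j k).

Lemma heat_leray_divE (i : 'I_3) g t x s : s < t ->
  heat_leray_div (t - s) (g s) x 0 i = slice i g t x s.
Proof.
move=> st; rewrite /heat_leray_div mxE; apply: eq_bigr => j _; apply: eq_bigr => k _.
by rewrite pd_oseen// subr_gt0.
Qed.

Lemma measurable_slice (i : 'I_3) g : jmeasurable_m g ->
  measurable_fun [set: (X * TT) * TT]
    (fun w : (X * TT) * TT => slice i g w.1.2 w.1.1 w.2).
Proof.
move=> mg; rewrite /slice; apply: measurable_sum => j; apply: measurable_sum => k.
apply: measurable_Rintegral_leb3; apply: measurable_funM.
  apply: measurable_kern_comp; last by mfun.
  by apply: measurable_sub3; mfun.
apply: (@measurableT_comp _ _ _ _ _ _ (fun z : X * TT => g z.2 z.1 j k) _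
  (fun z : ((X * TT) * TT) * X => (z.2, z.1.2))); first exact: mg.
by mfun.
Qed.

Lemma measurable_slice_time (i : 'I_3) g t x : jmeasurable_m g ->
  measurable_fun [set: TT] (fun s : TT => slice i g t x s).
Proof.
move=> mg; exact: (measurable_fun_pair2 ((x, t) : X * TT) (measurable_slice i mg)).
Qed.

Lemma Gop_slice (i : 'I_3) g t x :
  Gop g t x 0 i = \int[leb]_(s in `]0, t[) slice i g t x s.
Proof.
rewrite /Gop mxE; apply: eq_Rintegral => s; rewrite inE/= in_itv/= => /andP[_ st].
exact: heat_leray_divE.
Qed.

(** The domain ]0, t[ moves with the parameter t, so it is first made a condition inside an integral
    over the whole line. *)
Lemma measurable_Gop g : jmeasurable_m g -> jmeasurable_v (Gop g).
Proof.
move=> mg i.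
rewrite (_ : (fun z => _) = (fun z : X * TT => \int[leb]_s
    (if (0 < s) && (s < z.2) then slice i g z.2 z.1 s else 0))); last first.
  apply/funext => z; rewrite Gop_slice Rintegral_mkcond; apply: eq_Rintegral => s _.
  by rewrite patchE mem_setE in_itv.
apply: (@measurable_fun_Rintegral _ _ _ _ _ leb
  (fun (z : X * TT) (s : TT) => if (0 < s) && (s < z.2) then slice i g z.2 z.1 s else 0)).
apply: measurable_fun_ifT => //.
  by apply: measurable_and; apply: measurable_fun_ltr; mfun.
exact: measurable_slice.
Qed.

Lemma integral_kern_mul_le (i j k : 'I_3) tau x (f : X -> R) D : 0 < tau ->
  measurable_fun setT f -> (forall y, `|f y| <= D) ->
  (\int[leb3]_y `|(kern i j k tau (x - y) * f y)%:E| <=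
    (D * (kern_const * (Num.sqrt tau)^-1))%:E)%E.
Proof.
move=> t0 mf fD; have D0 : 0 <= D by apply: le_trans (fD 0).
have mk : measurable_fun [set: X] (fun y : X => kern i j k tau (x - y)).
  by apply: measurable_kern_comp; [apply: measurable_sub3; mfun|mfun].
apply: (@le_trans _ _ (\int[leb3]_y (D%:E * `|kern i j k tau (x - y)|%:E))%E).
  apply: ge0_le_integral; [by []|by move=> y _; exact: abse_ge0| | |].
  - by apply: measurable_fun_abse; mfun.
  - by mfun.
  - move=> y _; rewrite -EFinM lee_fin normrM mulrC; exact: ler_pM.
rewrite ge0_integralZl//; last by mfun.
by rewrite EFinM; apply: lee_wpmul2l; [rewrite lee_fin|exact: kern_L1].
Qed.

Lemma integrable_kern_mul (i j k : 'I_3) tau x (f : X -> R) D : 0 < tau ->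
  measurable_fun setT f -> (forall y, `|f y| <= D) ->
  leb3.-integrable [set: X] (fun y : X => (kern i j k tau (x - y) * f y)%:E).
Proof.
move=> t0 mf fD; apply/integrableP; split.
  apply: measurable_fun_EFin; apply: measurable_funM => //.
  by apply: measurable_kern_comp; [apply: measurable_sub3; mfun|mfun].
exact: le_lt_trans (integral_kern_mul_le i j k x t0 mf fD) (ltry _).
Qed.

Lemma Rintegral_kern_mul_le (i j k : 'I_3) tau x (f : X -> R) D : 0 < tau ->
  measurable_fun setT f -> (forall y, `|f y| <= D) ->
  `|\int[leb3]_y (kern i j k tau (x - y) * f y)| <=
    D * (kern_const * (Num.sqrt tau)^-1).
Proof.
move=> t0 mf fD; have I := integrable_kern_mul i j k x t0 mf fD.
rewrite -lee_fin EFin_normr_Rintegral//.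
apply: (le_trans _ (integral_kern_mul_le i j k x t0 mf fD)).
by apply: le_abse_integral => //; exact: (measurable_int _ I).
Qed.

Lemma measurable_m_section g s (j k : 'I_3) : jmeasurable_m g ->
  measurable_fun [set: X] (fun y : X => g s y j k).
Proof. by move=> mg; exact: (measurable_fun_pair1 s (mg j k)). Qed.

Lemma slice_le (i : 'I_3) g t x s D : jmeasurable_m g -> s < t ->
  (forall y j k, `|g s y j k| <= D) ->
  `|slice i g t x s| <= 9 * (D * (kern_const * (Num.sqrt (t - s))^-1)).
Proof.
move=> mg st gD; rewrite /slice; apply: (le_trans (ler_norm_sum _ _ _)).
have sum9 (c : R) : \sum_(j < 3) \sum_(k < 3) c = 9 * c.
  by rewrite !big_ord_recr !big_ord0/=; ring.
rewrite -sum9.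
apply: ler_sum => j _; apply: (le_trans (ler_norm_sum _ _ _)); apply: ler_sum => k _.
apply: Rintegral_kern_mul_le; rewrite ?subr_gt0//.
exact: measurable_m_section.
Qed.

(** Nine pairs (j, k), the L^1 bound of each kernel, and sqrt pi from the Laplace transform of
    s^(-1/2). *)
Definition op_const : R := 9 * kern_const * Num.sqrt pi.

Lemma op_const_gt0 : 0 < op_const.
Proof. by rewrite /op_const !mulr_gt0 ?sqrtr_gt0 ?pi_gt0 ?kern_const_gt0. Qed.

Section ExponentialBound.
Variables (g : mfield_t R) (l D : R).
Hypotheses (mg : jmeasurable_m g) (l0 : 0 < l).
Hypothesis gD : forall s y j k, `|g s y j k| <= D * expR (l * s).

Let D0 : 0 <= D.
Proof. by have := le_trans (normr_ge0 _) (gD 0 0 0 0); rewrite mulr0 expR0 mulr1. Qed.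

Lemma integral_slice_le (i : 'I_3) t x : 0 <= t ->
  (\int[leb]_(s in `]0%R, t[) `|(slice i g t x s)%:E| <=
    (op_const / Num.sqrt l * D * expR (l * t))%:E)%E.
Proof.
move=> t0; have kc0 := @kern_const_gt0 R.
apply: (@le_trans _ _ (\int[leb]_(s in `]0%R, t[)
    ((9 * D * kern_const)%:E * ((Num.sqrt (t - s))^-1 * expR (l * s))%:E))%E).
  apply: ge0_le_integral; [by []|by move=> s _; exact: abse_ge0| | |].
  - apply: measurable_funTS; apply: measurable_fun_abse; apply: measurable_fun_EFin.
    exact: measurable_slice_time.
  - by apply: measurable_funTS; mfun.
  - move=> s; rewrite /= in_itv/= => /andP[s0 st]; rewrite -EFinM lee_fin.
    apply: (le_trans (slice_le i x mg st (gD s))).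
    by rewrite le_eqVlt; apply/orP; left; apply/eqP; ring.
rewrite ge0_integralZl//; first last.
- by rewrite lee_fin; nneg.
- by apply: measurable_funTS; mfun.
apply: (@le_trans _ _ ((9 * D * kern_const)%:E * (Num.sqrt (pi / l) * expR (l * t))%:E)%E).
  apply: lee_wpmul2l; first by rewrite lee_fin; nneg.
  exact: integral_sqrtV_expR.
rewrite -EFinM lee_fin sqrtrM ?pi_ge0// sqrtrV ?(ltW l0)// /op_const.
by rewrite le_eqVlt; apply/orP; left; apply/eqP; ring.
Qed.

Lemma integrable_slice (i : 'I_3) t x : 0 <= t ->
  leb.-integrable (`]0, t[%classic : set TT) (fun s : TT => (slice i g t x s)%:E).
Proof.
move=> t0; apply/integrableP; split.
  by apply: measurable_funTS; apply: measurable_fun_EFin; exact: measurable_slice_time.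
exact: le_lt_trans (integral_slice_le i x t0) (ltry _).
Qed.

Lemma Gop_le (i : 'I_3) t x : 0 <= t ->
  `|Gop g t x 0 i| <= op_const / Num.sqrt l * D * expR (l * t).
Proof.
move=> t0; rewrite Gop_slice -lee_fin EFin_normr_Rintegral//; last exact: integrable_slice.
apply: (le_trans _ (integral_slice_le i x t0)).
apply: le_abse_integral => //.
by apply: measurable_funTS; apply: measurable_fun_EFin; exact: measurable_slice_time.
Qed.

End ExponentialBound.

Lemma GopB (g h : mfield_t R) l D D' (i : 'I_3) t x :
  jmeasurable_m g -> jmeasurable_m h -> 0 < l -> 0 <= t ->
  (forall s y j k, `|g s y j k| <= D * expR (l * s)) ->
  (forall s y j k, `|h s y j k| <= D' * expR (l * s)) ->
  Gop g t x 0 i - Gop h t x 0 i = Gop (fun s y => g s y - h s y) t x 0 i.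
Proof.
move=> mg mh l0 t0 gD hD.
have Ig := integrable_slice mg l0 gD i x t0.
have Ih := integrable_slice mh l0 hD i x t0.
transitivity (\int[leb]_(s in `]0, t[) slice i g t x s -
    \int[leb]_(s in `]0, t[) slice i h t x s).
  by congr (_ - _); exact: Gop_slice.
transitivity (\int[leb]_(s in `]0, t[) slice i (fun s y => g s y - h s y) t x s);
  last by apply/esym; exact: Gop_slice.
rewrite -(RintegralB _ Ig Ih); last by [].
apply: eq_Rintegral => s; rewrite inE/= in_itv/= => /andP[_ st].
rewrite /slice -sumrB; apply: eq_bigr => j _; rewrite -sumrB; apply: eq_bigr => k _.
rewrite -RintegralB//; last 2 first.
- by apply: (integrable_kern_mul _ _ _ _ _ _ (gD s ^~ j ^~ k)); rewrite ?subr_gt0//;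
    exact: measurable_m_section.
- by apply: (integrable_kern_mul _ _ _ _ _ _ (hD s ^~ j ^~ k)); rewrite ?subr_gt0//;
    exact: measurable_m_section.
by apply: eq_Rintegral => y _; rewrite !mxE mulrBr.
Qed.

Lemma Gop_ae_eq (g h : mfield_t R) t x : jmeasurable_m g -> jmeasurable_m h ->
  {ae leb, forall s, 0 < s < t -> {ae leb3, forall y, g s y = h s y}} ->
  Gop g t x = Gop h t x.
Proof.
move=> mg mh gh; apply/rowP => i; 
transitivity (\int[leb]_(s in `]0, t[) slice i g t x s); first exact: Gop_slice.
transitivity (\int[leb]_(s in `]0, t[) slice i h t x s);
  last by apply/esym; exact: Gop_slice.
rewrite /Rintegral; congr fine.
apply: ae_eq_integral => //.
- by apply: measurable_funTS; apply: measurable_fun_EFin; exact: measurable_slice_time.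
- by apply: measurable_funTS; apply: measurable_fun_EFin; exact: measurable_slice_time.
apply: ae_impl gh => s /= gh; rewrite in_itv/= => s0t; congr EFin.
apply: eq_bigr => j _; apply: eq_bigr => k _; rewrite /Rintegral; congr fine.
have mK (f : mfield_t R) : jmeasurable_m f -> measurable_fun [set: X]
    (fun y : X => (kern i j k (t - s) (x - y) * f s y j k)%:E).
  move=> mf; apply: measurable_fun_EFin; apply: measurable_funM; last exact: measurable_m_section.
  by apply: measurable_kern_comp; [apply: measurable_sub3; mfun|mfun].
apply: ae_eq_integral => //; [exact: mK|exact: mK|].
by apply: ae_impl (gh s0t) => y /= -> _.
Qed.

Lemma measurable_heat w : (forall i, measurable_fun [set: X] (fun x : X => w x 0 i)) ->
  jmeasurable_v (fun t => heat t w).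
Proof.
move=> mw i; rewrite /heat; under eq_fun do rewrite mxE.
apply: (@measurable_Rintegral_leb3 _ _ _
  (fun (z : X * TT) y => heat_kernel z.2 (z.1 - y) * w y 0 i)).
apply: measurable_funM.
  by apply: measurable_heat_kernel_comp; [apply: measurable_sub3; mfun|mfun].
by apply: (@measurableT_comp _ _ _ _ _ _ (fun y : X => w y 0 i) _ snd).
Qed.

Section HeatBound.
Variables (t D : R) (f : X -> R) (x : space3 R).
Hypotheses (t0 : 0 < t) (mf : measurable_fun setT f).
Hypothesis fD : {ae leb3, forall y, `|f y| <= D}.

Let mhk : measurable_fun [set: X] (fun y : X => heat_kernel t (x - y)).
Proof. by apply: measurable_heat_kernel_comp; [apply: measurable_sub3; mfun|mfun]. Qed.

Let hk0 y : 0 <= heat_kernel t (x - y).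
Proof. by rewrite mulr_ge0 ?powR_ge0 ?expR_ge0. Qed.

Lemma integral_heat_mul_le : 0 <= D ->
  (\int[leb3]_y `|(heat_kernel t (x - y) * f y)%:E| <= D%:E)%E.
Proof.
move=> D0; apply: (@le_trans _ _ (\int[leb3]_y (D%:E * (heat_kernel t (x - y))%:E))%E).
  apply: ae_ge0_le_integral; [by []|by move=> y _; exact: abse_ge0| | | |].
  - by apply: measurable_fun_abse; mfun.
  - by move=> y _; rewrite -EFinM lee_fin mulr_ge0.
  - by mfun.
  - apply: ae_impl fD => y yD _; rewrite -EFinM lee_fin normrM (ger0_norm (hk0 y)) mulrC.
    exact: ler_wpM2r.
rewrite ge0_integralZl//; first last.
- by move=> y _; rewrite lee_fin.
- by mfun.
by rewrite integral_heat_kernel// mule1.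
Qed.

Lemma integrable_heat_mul : 0 <= D ->
  leb3.-integrable [set: X] (fun y : X => (heat_kernel t (x - y) * f y)%:E).
Proof.
move=> D0; apply/integrableP; split; first by mfun.
exact: le_lt_trans (integral_heat_mul_le D0) (ltry _).
Qed.

Lemma convol_heat_le : 0 <= D -> `|convol (heat_kernel t) f x| <= D.
Proof.
move=> D0; rewrite -lee_fin EFin_normr_Rintegral//; last exact: integrable_heat_mul.
apply: (le_trans _ (integral_heat_mul_le D0)).
by apply: le_abse_integral => //; mfun.
Qed.

End HeatBound.

Lemma leb4_ysection (N : set (X * TT)) : measurable N ->
  leb4 N = (\int[leb]_s leb3 (ysection N s))%E.
Proof.
move=> mN; have := @indic_fubini_tonelli _ _ _ _ R (@leb3s R) leb N mN.
have -> := @indic_fubini_tonelli_GE _ _ _ _ R (@leb3s R) N mN.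
have -> := @indic_fubini_tonelli_FE _ _ _ _ R leb N mN.
by [].
Qed.

(** Links the two kinds of null sets: [Linf_slab] refers to [leb4], the equation of a mild solution
    to [leb3] at each time. *)
Lemma leb4_null (N : set (X * TT)) : measurable N ->
  leb4 N = 0%E <-> {ae leb, forall s, leb3 (ysection N s) = 0%E}.
Proof.
move=> mN; rewrite leb4_ysection//.
have mS : measurable_fun [set: TT] (fun s : TT => leb3 (ysection N s)).
  exact: (@measurable_fun_ysection _ _ _ _ R (@leb3s R) N mN).
have E : (\int[leb]_s leb3 (ysection N s) = \int[leb]_s `|leb3 (ysection N s)|)%E.
  by apply: eq_integralT => s; rewrite gee0_abs.
split=> [h|h].
  have := (ae_eq_integral_abs leb measurableT mS).1; rewrite -E h => /(_ erefl).
  by apply: ae_impl => s /(_ Logic.I).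
rewrite E; apply: (ae_eq_integral_abs leb measurableT mS).2.
by apply: ae_impl h => s -> _.
Qed.

Lemma ae_leb4_sections (P : X * TT -> Prop) : {ae leb4, forall z, P z} ->
  {ae leb, forall s, {ae leb3, forall y, P (y, s)}}.
Proof.
move=> [N [mN N0 PN]]; have := (leb4_null mN).1 N0; apply: ae_impl => s Ns.
exists (ysection N s); split => //; first exact: measurable_ysection.
by move=> y /= nP; rewrite /ysection/= inE; exact: PN.
Qed.

Lemma enorm_ge0 (a : 'rV[R]_3) : 0 <= enorm a.
Proof. exact: sqrtr_ge0. Qed.

Lemma enorm_sq (a : 'rV[R]_3) : enorm a ^+ 2 = \sum_i a 0 i ^+ 2.
Proof. by rewrite sqr_sqrtr// sumr_ge0// => i _; exact: sqr_ge0. Qed.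

Lemma coord_le_enorm (a : 'rV[R]_3) i : `|a 0 i| <= enorm a.
Proof.
rewrite -(ger0_norm (enorm_ge0 a)) -ler_sqr ?nnegrE// !real_normK ?num_real//.
rewrite enorm_sq (bigD1 i)//= lerDl sumr_ge0// => j _; exact: sqr_ge0.
Qed.

(** Squaring gives |a|^2 <= |b|^2 + 6 |b| D + 3 D^2 <= (|b| + 3 D)^2. *)
Lemma enorm_le_near (a b : 'rV[R]_3) D : (forall i, `|a 0 i - b 0 i| <= D) ->
  enorm a <= enorm b + 3 * D.
Proof.
move=> abD; have D0 : 0 <= D by apply: le_trans (abD 0).
have b0 := enorm_ge0 b.
rewrite -(ger0_norm (enorm_ge0 a)) -[leRHS]ger0_norm; last by nneg.
rewrite -ler_sqr ?nnegrE// !real_normK ?num_real//.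
rewrite enorm_sq; apply: (@le_trans _ _ (\sum_(i < 3) (b 0 i ^+ 2 + (2 * enorm b * D + D ^+ 2)))).
  apply: ler_sum => i _; have := abD i; have := coord_le_enorm b i.
  set c := a 0 i - b 0 i => bi ci; have -> : a 0 i = b 0 i + c by rewrite /c; ring.
  rewrite sqrrD -addrA lerD2l; apply: lerD.
    rewrite -mulr_natl -mulrA; apply: ler_wpM2l => //.
    by apply: (le_trans (ler_norm _)); rewrite normrM; exact: ler_pM.
  by rewrite -real_normK ?num_real// lerXn2r ?nnegrE.
rewrite big_split/= -enorm_sq sumr_const card_ord -mulr_natl.
have := sqr_ge0 D; lra.
Qed.

End Operators.

(** * The iteration *)

Section Picard.
Context {R : realType}.
Local Notation leb := (@lebesgue_measure R).
Local Notation leb3 := (@leb3 R).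
Local Notation leb4 := (@leb4 R).
Local Notation TT := (measurableTypeR R).
Local Notation X := (space3 (measurableTypeR R)).
Implicit Types (u v w : vfield_t R).

Lemma tensorE u v t x j k : tensor u v t x j k = u t x 0 j * v t x 0 k.
Proof. by rewrite /tensor mxE big_ord1 mxE. Qed.

Lemma jmeasurable_tensor u v : jmeasurable_v u -> jmeasurable_v v ->
  jmeasurable_m (tensor u v).
Proof.
move=> mu mv i j; under eq_fun do rewrite tensorE.
by apply: measurable_funM.
Qed.

Lemma BopE u v t x i : Bop u v t x 0 i = - Gop (tensor u v) t x 0 i.
Proof. by rewrite /Bop mxE. Qed.

Lemma jmeasurable_Bop u v : jmeasurable_v u -> jmeasurable_v v ->
  jmeasurable_v (Bop u v).
Proof.
move=> mu mv i; under eq_fun do rewrite BopE.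
by apply: measurable_funN; apply: measurable_Gop; exact: jmeasurable_tensor.
Qed.

Definition cut (S : set (X * TT)) u : vfield_t R :=
  fun t x => if (x, t) \in S then u t x else 0.

Lemma jmeasurable_cut (S : set (X * TT)) u : measurable S ->
  (forall i, measurable_fun S (fun z : X * TT => u z.2 z.1 0 i)) ->
  jmeasurable_v (cut S u).
Proof.
move=> mS mu i.
rewrite (_ : (fun z => _) = (fun z : X * TT => u z.2 z.1 0 i) \_ S).
  exact/(measurable_restrictT _ mS).
apply/funext => -[x t]; rewrite patchE /cut /=.
by case: ifPn => // _; rewrite mxE.
Qed.

Section Iteration.
(** Here [h] stands for the heat flow of the data, [v0] for the approximate solution and [E] for its
    residual. By [contr], B is 1/2-Lipschitz on the ball of radius 2M, 4M being the bilinear factor.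
    By [small], the total drift E (1 + 1/2 + 1/4 + ...) e^{lT} is at most M, so no iterate leaves
    the ball. *)
Variables (S : set (X * TT)) (T M E l : R) (h v0 : vfield_t R).
Hypotheses (mS : measurable S) (S0T : forall x t, S (x, t) -> 0 < t < T).
Hypotheses (M0 : 0 < M) (E0 : 0 <= E) (l0 : 0 < l).
Hypothesis contr : @op_const R / Num.sqrt l * (4 * M) <= 2^-1.
Hypothesis small : 2 * E * expR (l * T) <= M.
Hypotheses (mh : jmeasurable_v h) (mv0 : jmeasurable_v v0).
Hypothesis v0S : forall t x, ~ S (x, t) -> v0 t x = 0.
Hypothesis v0M : forall t x i, `|v0 t x 0 i| <= M.
Hypothesis step0 : forall t x i, S (x, t) ->
  `|h t x 0 i + Bop v0 v0 t x 0 i - v0 t x 0 i| <= E.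

Let admissible v := [/\ jmeasurable_v v, forall t x, ~ S (x, t) -> v t x = 0 &
  forall t x i, `|v t x 0 i| <= 2 * M].

Let tensor_bound v : admissible v -> forall s y j k,
  `|tensor v v s y j k| <= 4 * M ^+ 2 * expR (l * s).
Proof.
move=> [mv vS vM] s y j k; rewrite tensorE.
have [/S0T/andP[s0 _]|nS] := pselect (S (y, s)); last first.
  by rewrite vS// !mxE mul0r normr0; nneg.
rewrite normrM; apply: (@le_trans _ _ (4 * M ^+ 2)).
  rewrite (_ : 4 * M ^+ 2 = (2 * M) * (2 * M)); last by ring.
  exact: ler_pM.
rewrite ler_peMr//; first by nneg.
by rewrite -expR0 ler_expR mulr_ge0// ltW.
Qed.

Let Bop_contract v w (e : R) : admissible v -> admissible w -> 0 <= e ->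
  (forall t x i, `|v t x 0 i - w t x 0 i| <= e * expR (l * t)) ->
  forall t x i, 0 <= t ->
  `|Bop v v t x 0 i - Bop w w t x 0 i| <= 2^-1 * e * expR (l * t).
Proof.
move=> av aw e0 vw t x i t0.
have [mv vS vM] := av; have [mw wS wM] := aw.
have mtv := jmeasurable_tensor mv mv; have mtw := jmeasurable_tensor mw mw.
have EB : Bop v v t x 0 i - Bop w w t x 0 i =
    - (Gop (tensor v v) t x 0 i - Gop (tensor w w) t x 0 i).
  transitivity (- Gop (tensor v v) t x 0 i - - Gop (tensor w w) t x 0 i).
    by congr (_ - _); exact: BopE.
  by rewrite opprB opprK addrC.
rewrite EB normrN.
have -> : Gop (tensor v v) t x 0 i - Gop (tensor w w) t x 0 i =
    Gop (fun s y => tensor v v s y - tensor w w s y) t x 0 i.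
  exact: (GopB i x mtv mtw l0 t0 (tensor_bound av) (tensor_bound aw)).
have mD : jmeasurable_m (fun s y => tensor v v s y - tensor w w s y).
  move=> j k; rewrite (_ : (fun z => _) = (fun z : X * TT =>
    tensor v v z.2 z.1 j k - tensor w w z.2 z.1 j k)).
    by apply: measurable_funB; [exact: mtv|exact: mtw].
  by apply/funext => z; rewrite !mxE.
have bD s y j k : `|(tensor v v s y - tensor w w s y) j k| <= (4 * M * e) * expR (l * s).
  rewrite [X in `|X|](_ : _ = tensor v v s y j k - tensor w w s y j k); last by rewrite !mxE.
  rewrite !tensorE.
  set a := v s y 0 j; set b := v s y 0 k; set c := w s y 0 j; set f := w s y 0 k.
  (* Each product contains one difference and one factor bounded by 2M, which gives 4M. *)
  rewrite (_ : a * b - c * f = (a - c) * b + c * (b - f)); last by ring.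
  apply: (le_trans (ler_normD _ _)); rewrite !normrM.
  rewrite (_ : 4 * M * e * expR (l * s) =
    (e * expR (l * s)) * (2 * M) + (2 * M) * (e * expR (l * s))); last by ring.
  by apply: lerD; apply: ler_pM => //; [exact: vw|exact: vM|exact: wM|exact: vw].
apply: (le_trans (Gop_le mD l0 bD i x t0)).
rewrite ler_wpM2r ?expR_ge0// mulrA; apply: ler_wpM2r => //.
Qed.

Let next v : vfield_t R := cut S (fun t x => h t x + Bop v v t x).

Let vseq n : vfield_t R := iter n next v0.

Let nextE v t x i : S (x, t) -> next v t x 0 i = h t x 0 i + Bop v v t x 0 i.
Proof. by move=> Sxt; rewrite /next /cut mem_set// mxE. Qed.

Let next_out v t x : ~ S (x, t) -> next v t x = 0.
Proof. by move=> nS; rewrite /next /cut memNset. Qed.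

Let next_meas v : jmeasurable_v v -> jmeasurable_v (next v).
Proof.
move=> mv; apply: jmeasurable_cut => // i; apply: measurable_funTS.
under eq_fun do rewrite mxE.
by apply: measurable_funD; [exact: mh|exact: jmeasurable_Bop].
Qed.

Let half_pow n : (2^-1 : R) ^+ n = 2 * 2^-1 ^+ n.+1.
Proof. by rewrite exprS mulrA divff ?mul1r// pnatr_eq0. Qed.

Let close_admissible v : jmeasurable_v v -> (forall t x, ~ S (x, t) -> v t x = 0) ->
  (forall t x i, `|v t x 0 i - v0 t x 0 i| <= 2 * E * expR (l * t)) -> admissible v.
Proof.
move=> mv vS vv0; split=> // t x i.
have [/S0T/andP[_ tT]|nS] := pselect (S (x, t)); last first.
  by rewrite vS// mxE normr0; nneg.
rewrite -[v t x 0 i](subrK (v0 t x 0 i)); apply: (le_trans (ler_normD _ _)).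
rewrite (_ : 2 * M = M + M); last by ring.
apply: lerD => //; apply: (le_trans (vv0 t x i)); apply: le_trans small.
rewrite ler_wpM2l ?ler_expR; [by []|nneg|].
by rewrite ler_wpM2l// ltW.
Qed.

(** The three claims need one another: contraction requires admissible iterates, admissibility
    follows from closeness to [v0], and closeness is the partial sum of the steps. *)
Let vseq_bounds n : [/\ admissible (vseq n),
  (forall t x i, `|vseq n t x 0 i - v0 t x 0 i| <=
     2 * E * (1 - 2^-1 ^+ n) * expR (l * t)) &
  (forall t x i, `|vseq n.+1 t x 0 i - vseq n t x 0 i| <=
     E * 2^-1 ^+ n * expR (l * t))].
Proof.
have half0 k : 0 <= (2^-1 : R) ^+ k by nneg.
elim: n => [|n [an bn cn]].
  have a0 : admissible v0.
    apply: close_admissible => // t x i; rewrite subrr normr0; nneg.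
  split=> // t x i; first by rewrite subrr normr0 expr0 subrr mulr0 mul0r.
  rewrite expr0 mulr1 /vseq/=.
  have [St|nS] := pselect (S (x, t)); last first.
    by rewrite next_out// v0S// subrr normr0; nneg.
  rewrite nextE//; apply: (le_trans (step0 i St)); rewrite ler_peMr//.
  have /andP[t0 _] := S0T St.
  by rewrite -expR0 ler_expR mulr_ge0// ltW.
have bn1 t x i : `|vseq n.+1 t x 0 i - v0 t x 0 i| <=
    2 * E * (1 - 2^-1 ^+ n.+1) * expR (l * t).
  rewrite -[vseq n.+1 t x 0 i](subrK (vseq n t x 0 i)) -addrA.
  apply: (le_trans (ler_normD _ _)).
  apply: (le_trans (lerD (cn t x i) (bn t x i))).
  rewrite le_eqVlt; apply/orP; left; apply/eqP; rewrite (half_pow n); ring.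
have an1 : admissible (vseq n.+1).
  have [mn Sn _] := an.
  apply: close_admissible; [exact: next_meas|by move=> t x; exact: next_out|].
  move=> t x i; apply: (le_trans (bn1 t x i)).
  apply: ler_wpM2r; first exact: expR_ge0.
  rewrite -[leRHS]mulr1; apply: ler_wpM2l; first by nneg.
  by rewrite lerBlDr lerDl.
split=> // t x i.
have [St|nS] := pselect (S (x, t)); last first.
  by rewrite /vseq !iterS !next_out// subrr normr0; nneg.
have /andP[t0 _] := S0T St.
have e0 : 0 <= E * 2^-1 ^+ n by nneg.
have aux (p q b c d e e' : R) : p = b + c -> q = b + d -> `|c - d| <= e -> e = e' -> `|p - q| <= e'.
  by move=> -> -> cd <-; rewrite opprD addrACA subrr add0r.
have E1 : vseq n.+2 t x 0 i = h t x 0 i + Bop (vseq n.+1) (vseq n.+1) t x 0 i.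
  exact: (nextE _ _ St).
have E2 : vseq n.+1 t x 0 i = h t x 0 i + Bop (vseq n) (vseq n) t x 0 i.
  exact: (nextE _ _ St).
apply: (aux _ _ _ _ _ _ _ E1 E2 (Bop_contract an1 an e0 cn x i (ltW t0))).
by rewrite (half_pow n); field.
Qed.

Let vseq_dist n p t x i : `|vseq (n + p) t x 0 i - vseq n t x 0 i| <=
  2 * E * 2^-1 ^+ n * (1 - 2^-1 ^+ p) * expR (l * t).
Proof.
elim: p => [|p IH]; first by rewrite addn0 subrr normr0 expr0 subrr mulr0 mul0r.
have [_ _ /(_ t x i) c] := vseq_bounds (n + p).
rewrite addnS -[vseq (n + p).+1 t x 0 i](subrK (vseq (n + p) t x 0 i)) -addrA.
apply: (le_trans (ler_normD _ _)); apply: (le_trans (lerD c IH)).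
rewrite le_eqVlt; apply/orP; left; apply/eqP.
by rewrite exprD (half_pow p) exprS; field.
Qed.

Let vseq_cvg t x i : cvgn (fun n => vseq n t x 0 i).
Proof.
pose q n := vseq n t x 0 i.
(* At a fixed point the weight is a constant, and the telescoping series is dominated by a geometric
   one. *)
have -> : (fun n => vseq n t x 0 i) = (fun n => q 0%N + series (telescope q) n).
  by apply/funext => n; rewrite -eq_sum_telescope.
apply: is_cvgD; first exact: is_cvg_cst.
apply: normed_cvg.
apply: (@series_le_cvg _ _ (geometric (E * expR (l * t)) 2^-1)) => [n|n|n|].
- exact: normr_ge0.
- by rewrite /geometric/=; nneg.
- rewrite /geometric/= /telescope/=; have [_ _ /(_ t x i) c] := vseq_bounds n.
  by apply: (le_trans c); rewrite mulrAC.
- by apply: is_cvg_geometric_series; rewrite ger0_norm ?invr_ge0// invf_lt1// ltr1n.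
Qed.

Let vlim : vfield_t R := fun t x => \row_i limn (fun n => vseq n t x 0 i).

Let vlim_dist n t x i : `|vlim t x 0 i - vseq n t x 0 i| <=
  2 * E * 2^-1 ^+ n * expR (l * t).
Proof.
rewrite /vlim mxE; set c := 2 * _ * _ * _.
have H m : (n <= m)%N -> `|vseq m t x 0 i - vseq n t x 0 i| <= c.
  move=> /subnKC <-; apply: (le_trans (vseq_dist _ _ _ _ _)).
  apply: ler_wpM2r; first exact: expR_ge0.
  rewrite -[leRHS]mulr1; apply: ler_wpM2l; first by nneg.
  by rewrite lerBlDr lerDl; nneg.
rewrite ler_distl; apply/andP; split.
  apply: limr_ge; first exact: vseq_cvg.
  by exists n => // m /= nm; have := H m nm; rewrite ler_distl => /andP[].
apply: limr_le; first exact: vseq_cvg.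
by exists n => // m /= nm; have := H m nm; rewrite ler_distl => /andP[].
Qed.

Let half_squeeze (a C : R) : (forall n, `|a| <= C * 2^-1 ^+ n) -> a = 0.
Proof.
move=> H; apply/eqP; rewrite -normr_le0.
have hg : `|2^-1 : R| < 1 by rewrite ger0_norm ?invr_ge0// invf_lt1// ltr1n.
have G := @cvg_geometric R C 2^-1 hg.
rewrite -(cvg_lim _ G)//; apply: limr_ge; first by apply/cvg_ex; exists 0.
by apply: nearW => n; exact: H.
Qed.

Lemma picard_limit : exists v, [/\ jmeasurable_v v,
  forall t x, ~ S (x, t) -> v t x = 0,
  forall t x i, `|v t x 0 i| <= 2 * M,
  forall t x i, `|v t x 0 i - v0 t x 0 i| <= 2 * E * expR (l * t) &
  forall t x, S (x, t) -> v t x = h t x + Bop v v t x].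
Proof.
exists vlim.
have mlim : jmeasurable_v vlim.
  move=> i; apply: (@measurable_fun_cvg _ _ _ _ (fun n (z : X * TT) => vseq n z.2 z.1 0 i)).
    by move=> n; have [[mn _ _] _ _] := vseq_bounds n; exact: mn.
  by move=> z _; rewrite /vlim mxE; exact: vseq_cvg.
have vlim0 t x i : `|vlim t x 0 i - v0 t x 0 i| <= 2 * E * expR (l * t).
  by have := vlim_dist 0 t x i; rewrite expr0 mulr1.
have outlim t x : ~ S (x, t) -> vlim t x = 0.
  move=> nS; apply/rowP => i; rewrite [RHS]mxE.
  apply: (@half_squeeze _ (2 * E * expR (l * t))) => n.
  have [[_ out _] _ _] := vseq_bounds n; have := vlim_dist n t x i.
  have -> : vseq n t x 0 i = 0 by rewrite (out _ _ nS) mxE.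
  by rewrite subr0 (mulrAC _ (expR _)).
have alim : admissible vlim by exact: close_admissible.
split=> //; first by have [_ _ bl] := alim.
move=> t x St; apply/rowP => i.
have /andP[t0 _] := S0T St.
have aux (a a' b c d e e' e'' : R) : `|a - a'| <= e -> a' = b + d -> `|c - d| <= e' ->
    e + e' = e'' -> `|a - (b + c)| <= e''.
  move=> + a'E cd <-; rewrite a'E => ad.
  rewrite (_ : a - (b + c) = (a - (b + d)) - (c - d)); last by ring.
  by apply: (le_trans (ler_normB _ _)); exact: lerD.
(* The contraction itself passes to the limit: the defect is at most |vlim - v_{n+1}| + |B(v_n, v_n)
   - B(vlim, vlim)|, and each term is at most E 2^{-n} e^{lt}. *)
have D n : `|vlim t x 0 i - (h t x 0 i + Bop vlim vlim t x 0 i)| <=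
    2 * E * expR (l * t) * 2^-1 ^+ n.
  have [an _ _] := vseq_bounds n.
  have e0 : 0 <= 2 * E * 2^-1 ^+ n by nneg.
  have E2 : vseq n.+1 t x 0 i = h t x 0 i + Bop (vseq n) (vseq n) t x 0 i.
    exact: (nextE _ _ St).
  apply: (aux _ _ _ _ _ _ _ _ (vlim_dist n.+1 t x i) E2
    (Bop_contract alim an e0 (vlim_dist n) x i (ltW t0))).
  by rewrite (half_pow n); field.
have sum0 : vlim t x 0 i = h t x 0 i + Bop vlim vlim t x 0 i.
  by apply: subr0_eq; exact: (half_squeeze D).
by apply: (eq_trans sum0); rewrite [RHS]mxE.
Qed.

End Iteration.

End Picard.

(** * Stability *)

Section Stability.
Context {R : realType}.
Local Notation leb := (@lebesgue_measure R).
Local Notation leb3 := (@leb3 R).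
Local Notation leb4 := (@leb4 R).
Local Notation TT := (measurableTypeR R).
Local Notation X := (space3 (measurableTypeR R)).
Implicit Types (t s T l D : R) (x y : space3 R) (g h : mfield_t R)
  (u v : vfield_t R) (w : vfield R).

Lemma measurable_slab T : measurable (slab T : set (X * TT)).
Proof. by apply: measurableX => //; exact: measurable_itv. Qed.

Lemma slabE T x t : slab T (x, t) <-> 0 < t < T.
Proof. by rewrite /slab /=; split=> [[_]|h]; rewrite in_itv/=. Qed.

(** In contrast to [Gop_ae_eq], this asks for no measurability, so it applies to fields known to be
    measurable on the slab only. *)
Lemma eq_Gop g h t x : (forall s, 0 < s < t -> g s = h s) -> Gop g t x = Gop h t x.
Proof.
move=> gh; apply/rowP => i.
transitivity (\int[leb]_(s in `]0, t[) slice i g t x s); first exact: Gop_slice.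
transitivity (\int[leb]_(s in `]0, t[) slice i h t x s);
  last by apply/esym; exact: Gop_slice.
apply: eq_Rintegral => s; rewrite inE/= in_itv/= => st.
by rewrite /slice gh.
Qed.

Lemma eq_Bop u v t x : Gop (tensor u u) t x = Gop (tensor v v) t x ->
  Bop u u t x = Bop v v t x.
Proof. by rewrite /Bop => ->. Qed.

Lemma heat_leray_div0 t : heat_leray_div t (fun _ => 0 : 'M[R]_3) = fun _ => 0.
Proof.
apply/funext => x; apply/rowP => i; rewrite !mxE big1// => j _; rewrite big1// => k _.
by rewrite /convol /Rintegral integral0_eq// => y _; rewrite mxE mulr0.
Qed.

Lemma heat_leray0 t : heat_leray t (fun _ => 0 : 'rV[R]_3) = fun _ => 0.
Proof.
apply/funext => x; apply/rowP => i; rewrite !mxE big1// => j _.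
by rewrite /convol /Rintegral integral0_eq// => y _; rewrite mxE mulr0.
Qed.

Lemma Gop0 t x : Gop (fun _ _ => 0 : 'M[R]_3) t x = 0.
Proof.
apply/rowP => i; rewrite !mxE /Rintegral integral0_eq// => s _.
by rewrite heat_leray_div0 mxE.
Qed.

Lemma Fop0 t x : Fop (fun _ _ => 0 : 'rV[R]_3) t x = 0.
Proof.
apply/rowP => i; rewrite !mxE /Rintegral integral0_eq// => s _.
by rewrite heat_leray0 mxE.
Qed.

Lemma Fop_defined0 T : Fop_defined T (fun _ _ => 0 : 'rV[R]_3).
Proof.
split=> [i|t _].
  by rewrite (_ : (fun z => _) = cst 0)//; apply/funext => z; rewrite mxE.
apply: aeW => x i; split.
  apply: aeW => s _ j; rewrite /convol_defined (_ : (fun y => _) = cst 0%E).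
    exact: integrable0.
  by apply/funext => y; rewrite mxE mulr0.
rewrite (_ : (fun s => _) = cst 0%E); first exact: integrable0.
by apply/funext => s; rewrite heat_leray0 mxE.
Qed.

Lemma Gop_defined0 T : Gop_defined T (fun _ _ => 0 : 'M[R]_3).
Proof.
split=> [i j|t _].
  by rewrite (_ : (fun z => _) = cst 0)//; apply/funext => z; rewrite mxE.
apply: aeW => x i; split.
  apply: aeW => s _ j k; rewrite /convol_defined (_ : (fun y => _) = cst 0%E).
    exact: integrable0.
  by apply/funext => y; rewrite mxE mulr0.
rewrite (_ : (fun s => _) = cst 0%E); first exact: integrable0.
by apply/funext => s; rewrite heat_leray_div0 mxE.
Qed.

Lemma Gop_defined_bounded T g l D : jmeasurable_m g -> 0 < l ->
  (forall s y j k, `|g s y j k| <= D * expR (l * s)) -> Gop_defined T g.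
Proof.
move=> mg l0 gD; split=> [i j|t /andP[t0 tT]].
  by apply: measurable_funTS; exact: mg.
apply: aeW => x i; split.
  apply: aeW => s /andP[s0 st] j k; rewrite /convol_defined pd_oseen ?subr_gt0//.
  apply: (integrable_kern_mul i j k x (D := D * expR (l * s))); first by rewrite subr_gt0.
    exact: measurable_m_section.
  by move=> y; exact: gD.
have I := integrable_slice mg l0 gD i x (ltW t0).
apply: eq_integrable I; first exact: measurable_itv.
by move=> s; rewrite inE/= in_itv/= => /andP[_ st]; rewrite heat_leray_divE.
Qed.

Lemma in_Linf_bounded w : in_Linf w -> exists2 D, 0 <= D &
  {ae leb3, forall x, enorm (w x) <= D}.
Proof.
move=> [_ wy]; have L0 : (0 <= Linf w)%E by exact: Lnorm_ge0.
exists (fine (Linf w)); first exact: fine_ge0.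
have : (Linf w <= (fine (Linf w))%:E)%E by rewrite fineK// ge0_fin_numE.
by move/Lnormy_le_ae; apply: ae_impl => x; rewrite /= ger0_norm ?enorm_ge0.
Qed.

Lemma Linf_slab_sections T u D : (Linf_slab T u <= D%:E)%E ->
  {ae leb, forall s, {ae leb3, forall y, 0 < s < T -> enorm (u s y) <= D}}.
Proof.
move=> /Lnormy_le_ae h; have := ae_leb4_sections h; apply: ae_impl => s.
apply: ae_impl => y /=; rewrite patchE => + /slabE-/(_ y) sT.
by rewrite mem_set//= ger0_norm ?enorm_ge0.
Qed.

(** [D1] and [D2] make both convolutions converge, so that they may be subtracted; the bound is then
    the unit mass of the positive heat kernel. *)
Lemma heat_diff_le t w w' D D1 D2 x i : 0 < t -> 0 <= D -> 0 <= D1 -> 0 <= D2 ->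
  (forall i, measurable_fun [set: X] (fun x : X => w x 0 i)) ->
  (forall i, measurable_fun [set: X] (fun x : X => w' x 0 i)) ->
  {ae leb3, forall y, enorm (w y) <= D1} -> {ae leb3, forall y, enorm (w' y) <= D2} ->
  {ae leb3, forall y, enorm (w y - w' y) <= D} ->
  `|heat t w x 0 i - heat t w' x 0 i| <= D.
Proof.
move=> t0 D0 D10 D20 mw mw' wD wD' ww'.
have c1 : {ae leb3, forall y, `|w y 0 i| <= D1}.
  by apply: ae_impl wD => y; apply: le_trans; exact: coord_le_enorm.
have c2 : {ae leb3, forall y, `|w' y 0 i| <= D2}.
  by apply: ae_impl wD' => y; apply: le_trans; exact: coord_le_enorm.
have c : {ae leb3, forall y, `|w y 0 i - w' y 0 i| <= D}.
  apply: ae_impl ww' => y; apply: le_trans.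
  by rewrite (_ : w y 0 i - w' y 0 i = (w y - w' y) 0 i) ?coord_le_enorm// !mxE.
have I1 := integrable_heat_mul x t0 (mw i) c1 D10.
have I2 := integrable_heat_mul x t0 (mw' i) c2 D20.
have E : heat t w x 0 i - heat t w' x 0 i =
    convol (heat_kernel t) (fun y => w y 0 i - w' y 0 i) x.
  rewrite /heat !mxE /convol -RintegralB//.
  by apply: eq_Rintegral => y _; rewrite mulrBr.
rewrite E; apply: convol_heat_le => //.
exact: measurable_funB.
Qed.

Lemma heat_le t w D x i : 0 < t -> 0 <= D ->
  (forall i, measurable_fun [set: X] (fun x : X => w x 0 i)) ->
  {ae leb3, forall y, enorm (w y) <= D} -> `|heat t w x 0 i| <= D.
Proof.
move=> t0 D0 mw wD; rewrite /heat mxE; apply: convol_heat_le => //.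
by apply: ae_impl wD => y; apply: le_trans; exact: coord_le_enorm.
Qed.

Lemma measurable_le_set {d} {T : measurableType d} (f : T -> R) (c : R) :
  measurable_fun setT f -> measurable [set z | f z <= c].
Proof.
move=> mf; have := measurable_fun_ler mf (measurable_cst c).
move=> /(_ measurableT [set true]); rewrite setTI; apply.
by [].
Qed.

Lemma measurable_enorm {d} {T : measurableType d} (f : T -> 'rV[R]_3) :
  (forall i, measurable_fun setT (fun z => f z 0 i)) ->
  measurable_fun setT (fun z => enorm (f z)).
Proof.
move=> mf; rewrite /enorm; apply: measurable_fun_sqrt; apply: measurable_sum => i.
exact: measurable_funX.
Qed.

Lemma Linf_slab_le T u D : 0 <= D ->
  {ae leb4, forall z, slab T z -> enorm (u z.2 z.1) <= D} ->
  (Linf_slab T u <= D%:E)%E.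
Proof.
move=> D0 h; apply: Lnormy_ae_le => //; apply: ae_impl h => z h.
rewrite patchE; case: ifPn => [|_]; last by rewrite normr0.
by rewrite inE ger0_norm ?enorm_ge0//; exact: h.
Qed.

Lemma stability (A : R) (u0 u0e : vfield R) (eps M T : R) (fe : vfield_t R)
    (ge : mfield_t R) (ue : vfield_t R) : 0 < A ->
  in_Linf u0 -> in_Linf u0e -> 0 < eps -> 0 < M -> 0 < T ->
  (Linf_slab T (Fop fe) <= (A * eps * M ^+ 2)%:E)%E ->
  (Linf_slab T (Gop ge) <= (A * eps * M ^+ 2)%:E)%E ->
  (Linf (fun x => u0e x - u0 x)%R <= (A * eps * M ^+ 2)%:E)%E ->
  mild_solution T u0e fe ge ue ->
  (Linf_slab T ue <= M%:E)%E ->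
  eps <= (18 * A)^-1 * M^-1 * expR (- ((8 * @op_const R) ^+ 2 * T * M ^+ 2)) ->
  exists u : vfield_t R, mild_solution T u0 (fun _ _ => 0) (fun _ _ => 0) u /\
    (Linf_slab T u <= (2 * M)%:E)%E.
Proof.
move=> A0 u0L u0eL eps0 M0 T0 FD GD UD [mue _ _ eqe] ueM epsle.
have mu0 : forall i, measurable_fun [set: X] (fun x : X => u0 x 0 i) by case: u0L.
have mu0e : forall i, measurable_fun [set: X] (fun x : X => u0e x 0 i) by case: u0eL.
have [D0 D00 u0D] := in_Linf_bounded u0L.
have [D1 D10 u0eD] := in_Linf_bounded u0eL.
have oc0 := @op_const_gt0 R.
(* One [e0] each for the heat flow of [u0 - u0e], for [Fop fe] and for [Gop ge]. *)
pose e0 := A * eps * M ^+ 2; pose E := 3 * e0.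
have e00 : 0 <= e0 by rewrite /e0; nneg.
have E0 : 0 <= E by rewrite /E; nneg.
pose l := (8 * @op_const R * M) ^+ 2.
have l0 : 0 < l by rewrite /l exprn_gt0// mulr_gt0// mulr_gt0.
have sl : Num.sqrt l = 8 * @op_const R * M.
  by rewrite sqrtr_sqr ger0_norm//; nneg.
have contr : @op_const R / Num.sqrt l * (4 * M) <= 2^-1.
  rewrite sl le_eqVlt; apply/orP; left; apply/eqP.
  by field; rewrite (gt_eqF M0) (gt_eqF oc0).
(* 6 = 3 * 2: the drift is 2 E e^{lt} per coordinate, and [enorm_le_near] costs a factor 3. *)
have small : 6 * E * expR (l * T) <= M.
  have h : e0 <= M / 18 * expR (- (l * T)).
    rewrite /e0 (_ : A * eps * M ^+ 2 = eps * (A * M ^+ 2)); last by ring.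
    rewrite -ler_pdivlMr ?mulr_gt0 ?exprn_gt0//.
    apply: (le_trans epsle).
    rewrite (_ : (8 * op_const) ^+ 2 * T * M ^+ 2 = l * T); last by rewrite /l; ring.
    move: (expR _) => q; rewrite le_eqVlt; apply/orP; left; apply/eqP.
    by field; rewrite (gt_eqF M0) (gt_eqF A0).
  apply: (@le_trans _ _ (18 * (M / 18 * expR (- (l * T))) * expR (l * T))).
    apply: ler_wpM2r; first exact: expR_ge0.
    by rewrite /E mulrA (_ : 6 * 3 = 18) ?ler_wpM2l// -natrM.
  rewrite expRN; move: (expR_gt0 (l * T)) => q0; rewrite le_eqVlt; apply/orP; left; apply/eqP.
  by field; rewrite (gt_eqF q0).
have uexp s : 0 < s < T -> expR (l * s) <= expR (l * T).
  by move=> /andP[s0 sT]; rewrite ler_expR ler_wpM2l// ltW.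
(* The first cut makes [ue] measurable everywhere; the cut by B below turns its essential bound M
   into a pointwise one. *)
pose uc := cut (slab T) ue.
have muc : jmeasurable_v uc by apply: jmeasurable_cut => //; exact: measurable_slab.
pose B : set (X * TT) := [set z | enorm (uc z.2 z.1) <= M].
have mB : measurable B.
  by apply: measurable_le_set; apply: measurable_enorm => i; exact: muc.
pose up := cut B uc.
have mup : jmeasurable_v up.
  by apply: jmeasurable_cut => // i; apply: measurable_funTS; exact: muc.
have upM t x : enorm (up t x) <= M.
  rewrite /up /cut; case: ifPn => [|_]; first by rewrite inE.
  by rewrite /enorm big1 ?sqrtr0 ?ltW// => i _; rewrite mxE expr0n.
pose h : vfield_t R := fun t => heat t u0.
have mh : jmeasurable_v h by exact: measurable_heat.
(* S is defined by this residual, which is measurable by construction, and not by the error terms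
   [Fop fe] and [Gop ge]. *)
pose F i (z : X * TT) : R := h z.2 z.1 0 i + Bop up up z.2 z.1 0 i - up z.2 z.1 0 i.
have mF i : measurable_fun setT (F i).
  apply: measurable_funB; last exact: mup.
  by apply: measurable_funD; [exact: mh|exact: jmeasurable_Bop].
pose S : set (X * TT) := slab T `&` \bigcap_(i in [set: 'I_3]) [set z | `|F i z| <= E].
have mS : measurable S.
  apply: measurableI; first exact: measurable_slab.
  apply: fin_bigcap_measurable; first exact: finite_finset.
  by move=> i _; apply: measurable_le_set; exact: measurable_fun_norm.
have S0T x t : S (x, t) -> 0 < t < T by case=> /slabE.
have ueM' := Linf_slab_sections ueM.
have FD' := Linf_slab_sections FD.
have GD' := Linf_slab_sections GD.
have u0d : {ae leb3, forall y, enorm (u0 y - u0e y) <= e0}.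
  move/Lnormy_le_ae : UD; apply: ae_impl => y /=.
  rewrite ger0_norm ?enorm_ge0//; apply: le_trans.
  rewrite le_eqVlt; apply/orP; left; apply/eqP; congr Num.sqrt.
  by apply: eq_bigr => i _; rewrite !mxE -sqrrN opprB.
have upE : {ae leb, forall s, {ae leb3, forall y, 0 < s < T -> up s y = ue s y}}.
  apply: ae_impl ueM' => s; apply: ae_impl => y ys sT; have := ys sT.
  have ucE : uc s y = ue s y by rewrite /uc /cut mem_set//; exact/slabE.
  by move=> eM; rewrite /up /cut mem_set//= /B/= ucE.
have BE t x : 0 < t < T -> Bop ue ue t x = Bop up up t x.
  move=> /andP[t0 tT]; apply: eq_Bop.
  have tr s : 0 < s < t -> 0 < s < T by move=> /andP[-> st] /=; exact: lt_trans tT.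
  transitivity (Gop (tensor uc uc) t x).
    apply: eq_Gop => s /tr sT; apply/funext => y.
    by rewrite /tensor /uc /cut mem_set//; exact/slabE.
  apply: Gop_ae_eq; [exact: jmeasurable_tensor|exact: jmeasurable_tensor|].
  apply: ae_impl upE => s us /tr sT; apply: ae_impl us => y /(_ sT) uy.
  rewrite /tensor uy; have -> // : uc s y = ue s y.
  by rewrite /uc /cut mem_set//; exact/slabE.
have Sae : {ae leb, forall s, {ae leb3, forall y, 0 < s < T -> S (y, s)}}.
  apply: ae_impl (ae_and (ae_and FD' GD') upE) => s [[Fs Gs] us].
  have [sT|nsT] := boolP (0 < s < T); last by apply: aeW => y.
  apply: ae_impl (ae_and (ae_and Fs Gs) (ae_and us (eqe s sT))) => y.
  move=> [[/(_ sT) Fy /(_ sT) Gy] [/(_ sT) uy eqy]] _; split; first exact/slabE.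
  move=> i _ /=; rewrite /F/= uy -BE//.
  have /andP[s0 _] := sT.
  have hd := heat_diff_le y i s0 e00 D00 D10 mu0 mu0e u0D u0eD u0d.
  have Fi := le_trans (coord_le_enorm (Fop fe s y) i) Fy.
  have Gi := le_trans (coord_le_enorm (Gop ge s y) i) Gy.
  (* Subtracting the equation of [ue] cancels B and leaves the three error terms. *)
  have aux (a b f g c q : R) : `|a - b| <= e0 -> `|f| <= e0 -> `|g| <= e0 ->
      q = b + f + g + c -> `|a + c - q| <= E.
    move=> ab fE gE ->; rewrite (_ : a + c - (b + f + g + c) = (a - b) - f - g); last by ring.
    rewrite /E (_ : 3 * e0 = e0 + e0 + e0); last by ring.
    apply: (le_trans (ler_normB _ _)); apply: lerD => //.
    by apply: (le_trans (ler_normB _ _)); apply: lerD.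
  apply: (aux _ _ _ _ _ _ hd Fi Gi).
  move: (eqy) => /(congr1 (fun a : 'rV[R]_3 => a 0 i)) ->.
  rewrite mxE; congr (_ + _); rewrite mxE; congr (_ + _); rewrite mxE //.
pose v0 := cut S up.
have mv0 : jmeasurable_v v0.
  by apply: jmeasurable_cut => // i; apply: measurable_funTS; exact: mup.
have v0S t x : ~ S (x, t) -> v0 t x = 0 by move=> nS; rewrite /v0 /cut memNset.
have v0E t x : S (x, t) -> v0 t x = up t x by move=> Sx; rewrite /v0 /cut mem_set.
have v0M t x i : `|v0 t x 0 i| <= M.
  have [Sx|nS] := pselect (S (x, t)); last by rewrite v0S// mxE normr0 ltW.
  by rewrite v0E//; exact: le_trans (coord_le_enorm _ _) (upM _ _).
have Bv t x v v' : 0 < t < T -> jmeasurable_v v -> jmeasurable_v v' ->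
    (forall s y, S (y, s) -> v s y = v' s y) -> Bop v v t x = Bop v' v' t x.
  move=> /andP[t0 tT] mv mv' vv'; apply: eq_Bop.
  apply: Gop_ae_eq; [exact: jmeasurable_tensor|exact: jmeasurable_tensor|].
  apply: ae_impl Sae => s us /andP[s0 st]; apply: ae_impl us => y Sy.
  by rewrite /tensor vv'//; apply: Sy; rewrite s0 (lt_trans st tT).
have step0 t x i : S (x, t) -> `|h t x 0 i + Bop v0 v0 t x 0 i - v0 t x 0 i| <= E.
  have aux (a : R) (c c' q q' : 'rV[R]_3) : c = c' -> q = q' ->
      `|a + c' 0 i - q' 0 i| <= E -> `|a + c 0 i - q 0 i| <= E by move=> -> ->.
  move=> Sx; have [_ /(_ i Logic.I) Fi] := Sx.
  have Bx : Bop v0 v0 t x = Bop up up t x.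
    exact: Bv (S0T _ _ Sx) mv0 mup (fun s y => @v0E s y).
  exact: (aux _ _ _ _ _ Bx (v0E _ _ Sx) Fi).
have small' : 2 * E * expR (l * T) <= M.
  apply: le_trans small; apply: ler_wpM2r; first exact: expR_ge0.
  by apply: ler_wpM2r => //; rewrite ler_nat.
have [v [mv vS vM vv0 vE]] :=
  picard_limit mS S0T M0 E0 l0 contr small' mh mv0 v0S v0M step0.
(* [v] solves the equation on S only, and S has full sections only at almost every t. The right-hand
   side itself, taken on the whole slab, agrees with [v] on S; hence B(u, u) = B(v, v), and u solves
   the equation at every t. *)
pose u := cut (slab T) (fun t x => h t x + Bop v v t x).
have mu : jmeasurable_v u.
  apply: jmeasurable_cut; first exact: measurable_slab.
  move=> i; apply: measurable_funTS; under eq_fun do rewrite mxE.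
  by apply: measurable_funD; [exact: mh|exact: jmeasurable_Bop].
have uE t x : 0 < t < T -> u t x = h t x + Bop v v t x.
  by move=> tT; rewrite /u /cut mem_set//; exact/slabE.
have uv s y : S (y, s) -> u s y = v s y by move=> Sy; rewrite uE ?vE//; exact: S0T Sy.
have tvb s y j k : `|tensor v v s y j k| <= 4 * M ^+ 2 * expR (l * s).
  rewrite tensorE; have [Sx|nS] := pselect (S (y, s)); last first.
    by rewrite vS// !mxE mul0r normr0; nneg.
  rewrite normrM; apply: (@le_trans _ _ (4 * M ^+ 2)).
    by rewrite (_ : 4 * M ^+ 2 = (2 * M) * (2 * M)); [exact: ler_pM|ring].
  rewrite ler_peMr//; first by nneg.
  have /andP[s0 _] := S0T _ _ Sx.
  by rewrite -expR0 ler_expR mulr_ge0// ltW.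
(* A crude bound on [u] that also holds off S; it makes B(u, u) well defined. *)
pose C := D0 + @op_const R / Num.sqrt l * (4 * M ^+ 2) * expR (l * T).
have C0 : 0 <= C by rewrite /C; nneg.
have uC t x i : `|u t x 0 i| <= C.
  have [tT|ntT] := boolP (0 < t < T); last first.
    rewrite /u /cut memNset ?mxE ?normr0//.
    by move=> /slabE; rewrite (negPf ntT).
  rewrite uE// mxE; apply: (le_trans (ler_normD _ _)).
  have /andP[t0 _] := tT; apply: lerD; first exact: heat_le.
  rewrite BopE normrN.
  apply: (le_trans (Gop_le (jmeasurable_tensor mv mv) l0 tvb i x (ltW t0))).
  by apply: ler_wpM2l; [nneg|exact: uexp].
have tub s y j k : `|tensor u u s y j k| <= C ^+ 2 * expR (l * s).
  rewrite tensorE; have [sT|nsT] := boolP (0 < s < T); last first.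
    rewrite /u /cut memNset ?mxE ?mul0r ?normr0; first by nneg.
    by move=> /slabE; rewrite (negPf nsT).
  rewrite normrM; apply: (@le_trans _ _ (C ^+ 2)); first by rewrite expr2; exact: ler_pM.
  rewrite ler_peMr//; first by nneg.
  have /andP[s0 _] := sT.
  by rewrite -expR0 ler_expR mulr_ge0// ltW.
have u2M T' : T' <= T -> (Linf_slab T' u <= (2 * M)%:E)%E.
  move=> T'T; apply: Linf_slab_le; first by nneg.
  exists (slab T `\` S); split.
  - by apply: measurableD => //; exact: measurable_slab.
  - apply/leb4_null; first by apply: measurableD => //; exact: measurable_slab.
    apply: ae_impl Sae => s Ss.
    apply/negligibleP.
      by apply: measurable_ysection; apply: measurableD => //; exact: measurable_slab.
    apply: negligibleS Ss => y /=; rewrite /ysection/= inE => -[/slabE sT nS] Sy.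
    by apply: nS; exact: Sy.
  move=> [x t] /= nP; apply: contrapT => nN; apply: nP => /slabE/andP[t0 tT'].
  have tT : 0 < t < T by rewrite t0 (lt_le_trans tT' T'T).
  have Sx : S (x, t) by apply: contrapT => nS; apply: nN; split => //; exact/slabE.
  (* The coordinate bound 2M on [v] would not give 2M for the Euclidean norm; closeness to [v0],
     whose Euclidean norm is at most M, does. *)
  rewrite uv//; apply: (@le_trans _ _ (enorm (v0 t x) + 3 * (2 * E * expR (l * t)))).
    by apply: enorm_le_near => i; exact: vv0.
  rewrite (_ : 2 * M = M + M); last by ring.
  apply: lerD; first by rewrite v0E.
  apply: le_trans small; rewrite (_ : 3 * _ = 6 * E * expR (l * t)); last by ring.
  by apply: ler_wpM2l; [nneg|exact: uexp].
exists u; split; last exact: u2M.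
split.
- by move=> i; apply: measurable_funTS; exact: mu.
- by move=> T' /andP[_ T'T]; exact: le_lt_trans (u2M _ (ltW T'T)) (ltry _).
- split; [exact: Fop_defined0|exact: Gop_defined0|].
  exact: (Gop_defined_bounded T (jmeasurable_tensor mu mu) l0 tub).
- have aux (a b b' f g : 'rV[R]_3) : b = b' -> f = 0 -> g = 0 -> a + b = a + f + g + b'.
    by move=> -> -> ->; rewrite !addr0.
  move=> t tT; apply: aeW => x; transitivity (h t x + Bop v v t x); first exact: uE.
  by apply: aux; [apply/esym; exact: Bv|exact: Fop0|exact: Gop0].
Qed.

End Stability.

Theorem theorem1p1 (R : realType) (A : R) (hA : 0 < A) :
  exists delta1 mu1 : R, [/\ 0 < delta1, 0 < mu1 &
    forall (u0 : vfield R) (eps M T : R) (u0e : vfield R)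
      (fe : vfield_t R) (ge : mfield_t R) (ue : vfield_t R),
    in_Linf u0 -> div_free u0 ->
    0 < eps -> 0 < M -> 0 < T ->
    in_Linf u0e -> div_free u0e ->
    (forall sigma : R, 0 <= sigma < T ->
      Fop_defined (T - sigma) (time_shift sigma fe) /\
      Gop_defined (T - sigma) (time_shift sigma ge)) ->
    (forall sigma : R, 0 <= sigma < T ->
      C_Linf (T - sigma) (Fop (time_shift sigma fe)) /\
      C_Linf (T - sigma) (Gop (time_shift sigma ge))) ->
    (forall sigma : R, 0 <= sigma < T ->
      Linf (Fop (time_shift sigma fe) t) @[t --> 0^'+] --> 0%E /\
      Linf (Gop (time_shift sigma ge) t) @[t --> 0^'+] --> 0%E) ->
    (forall sigma : R, 0 <= sigma < T ->
      (Linf_slab (T - sigma) (Fop (time_shift sigma fe))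
         <= (A * eps * M ^+ 2)%:E)%E /\
      (Linf_slab (T - sigma) (Gop (time_shift sigma ge))
         <= (A * eps * M ^+ 2)%:E)%E) ->
    (Linf (fun x => u0e x - u0 x)%R <= (A * eps * M ^+ 2)%:E)%E ->
    mild_solution T u0e fe ge ue ->
    (Linf_slab T ue <= M%:E)%E ->
    eps <= delta1 * M^-1 * expR (- (mu1 * T * M ^+ 2)) ->
    exists u : vfield_t R,
      mild_solution T u0 (fun _ _ => 0) (fun _ _ => 0) u /\
      (Linf_slab T u <= (2 * M)%:E)%E].
Proof.
exists (18 * A)^-1, ((8 * @op_const R) ^+ 2); split.
- by rewrite invr_gt0 mulr_gt0.
- by rewrite exprn_gt0// mulr_gt0// op_const_gt0.
move=> u0 eps M T u0e fe ge ue u0L _ eps0 M0 T0 u0eL _ _ _ _ bounds UD sol ueM epsle.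
have [] := bounds 0; first by rewrite lexx.
have shift0 (V : Type) (f : R -> V) : time_shift 0 f = f.
  by apply/funext => t; rewrite /time_shift addr0.
rewrite !shift0 subr0 => FD GD.
exact: (stability hA u0L u0eL eps0 M0 T0 FD GD UD sol ueM epsle).
Qed.
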